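(* Let $G=(V,E)$ be a finite directed graph in which every vertex has an incoming edge and an outgoing edge, with $|E|\ge 2$. For $u,v\in V$ let $A_G(v,u)$ be the number of edges from $v$ to $u$ in $G$. Then for every $n=0,1,2,\dots$ and every $u\in V$, $$c_{n+1}^G(u)=\sum_{k=0}^n c_{n-k}^G(u)\sum_{v\in V}A_G(v,u)\,c_k^G(v).$$
   Context: For $e\in E$ let $s(e),t(e)$ be its source and terminal vertex; loops and multiple edges are allowed. Let $A^G(e,f)=1$ if $t(e)=s(f)$ and $0$ otherwise ($e,f\in E$). $\mathcal{O}_{A^G}$ is the Cuntz-Krieger algebra: the universal $C^*$-algebra generated by partial isometries $S_e$, $e\in E$, with $\sum_{f\in E}S_fS_f^*=1$ and $S_e^*S_e=\sum_{f\in E}A^G(e,f)S_fS_f^*$. For $v\in V$ put $P_v=\sum_{f\in E,\,s(f)=v}S_fS_f^*$. Let $\Sigma_G=\{S_e^*,S_e\mid e\in E\}$ (a set of $2|E|$ symbols). For a word $X=(X_1,\dots,X_{2n})$ in $\Sigma_G$ put $\pi_G(X)=X_1\cdots X_{2n}\in\mathcal{O}_{A^G}$. Let $\Phi_G$ replace each $S_e$ (resp. $S_e^*$) by the canonical isometry indexed by $e$ (resp. its adjoint) in the Cuntz algebra $\mathcal{O}_{|E|}$ generated by isometries $\{\hat S_e\}_{e\in E}$ with $\hat S_e^*\hat S_e=1$, $\sum_e\hat S_e\hat S_e^*=1$. For $n\ge1$, $B_n^G$ is the set of words $X$ of length $2n$ in $\Sigma_G$ with $\pi_G(X)\neq0$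 in $\mathcal{O}_{A^G}$ and $\Phi_G(X_1)\cdots\Phi_G(X_{2n})=1$ in $\mathcal{O}_{|E|}$. For each $X\in B_n^G$ there is a unique vertex $v(X)$ with $\pi_G(X)=P_{v(X)}$. For $u\in V$ put $c_0^G(u)=1$ and, for $n\ge1$, $c_n^G(u)=|\{X\in B_n^G\mid v(X)=u\}|$. *)

(* Defs.v *)
From HB Require Import structures.
From mathcomp Require Import all_boot all_order all_algebra.
From mathcomp Require Import complex.
From mathcomp Require Import boolp classical_sets reals topology normedtype.

Set Implicit Arguments.
Unset Strict Implicit.
Unset Printing Implicit Defensive.

Import Order.TTheory GRing.Theory Num.Theory.
Import numFieldNormedType.Exports.

Local Open Scope complex_scope.
Local Open Scope ring_scope.

(* Unital complex C*-algebras: a complex Banach space with a product, a unit and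
   an involution.  The ring structure is part of the mixin because Hierarchy
   Builder rejects a join of normed modules with rings declared above
   [numDomainType].  The zero algebra (1 = 0) is allowed. *)
HB.mixin Record isCStarAlgebra (R : realType) A
    of CompleteNormedModule R[i] A := {
  cstar1 : A;
  cmul : A -> A -> A;
  star : A -> A;
  cmulA : associative cmul;
  cmul1x : left_id cstar1 cmul;
  cmulx1 : right_id cstar1 cmul;
  cmulDl : left_distributive cmul +%R;
  cmulDr : right_distributive cmul +%R;
  cscaleAl : forall (a : R[i]) (x y : A), a *: cmul x y = cmul (a *: x) y;
  cscaleAr : forall (a : R[i]) (x y : A), a *: cmul x y = cmul x (a *: y);
  cnormM : forall x y : A, `|cmul x y| <= `|x| * `|y|;
  starK : involutive star;
  starD : {morph star : x y / x + y};
  starZ : forall (a : R[i]) (x : A), star (a *: x) = a^* *: star x;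
  starM : forall x y : A, star (cmul x y) = cmul (star y) (star x);
  cstar_identity : forall x : A, `|cmul (star x) x| = `|x| ^+ 2
}.

#[short(type="cstarAlgType")]
HB.structure Definition CStarAlgebra (R : realType) :=
  {A of isCStarAlgebra R A & CompleteNormedModule R[i] A}.

Arguments cstar1 {R s}.

Local Notation "x ** y" := (cmul x y) (at level 40, left associativity).

Section UniversalCStarAlgebras.
Variable R : realType.

(* Boundedness is automatic for *-homomorphisms of C*-algebras. *)
Definition star_morphism (A B : cstarAlgType R) (phi : A -> B) : Prop :=
  [/\ linear phi,
      phi cstar1 = cstar1,
      {morph phi : x y / x ** y} &
      {morph phi : x / star x}].

Definition closed_star_subalgebra (A : cstarAlgType R) (D : set A) : Prop :=
  [/\ closed D,
      D cstar1,
      (forall (a : R[i]) x y, D x -> D y -> D (a *: x + y)),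
      (forall x y, D x -> D y -> D (x ** y)) &
      (forall x, D x -> D (star x))].

Definition generates (E : Type) (A : cstarAlgType R) (S : E -> A) : Prop :=
  forall D : set A,
    closed_star_subalgebra D -> (forall e, D (S e)) -> D = setT.

(* [rels] is a set of relations, i.e. a property of E-indexed families in unital
   C*-algebras. *)
Definition universal_cstar_algebra (E : Type)
    (rels : forall B : cstarAlgType R, (E -> B) -> Prop)
    (A : cstarAlgType R) (S : E -> A) : Prop :=
  [/\ rels A S,
      generates S &
      forall (B : cstarAlgType R) (T : E -> B), rels B T ->
        exists phi : A -> B, star_morphism phi /\ forall e, phi (S e) = T e].

Definition partial_isometry (A : cstarAlgType R) (x : A) : Prop :=
  x ** star x ** x = x.

Definition cuntz_krieger_family (E : finType) (M : E -> E -> nat)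
    (A : cstarAlgType R) (S : E -> A) : Prop :=
  [/\ (forall e, partial_isometry (S e)),
      \sum_f S f ** star (S f) = cstar1 &
      forall e, star (S e) ** S e = \sum_f (S f ** star (S f)) *+ M e f].

Definition is_cuntz_krieger_algebra (E : finType) (M : E -> E -> nat)
    (A : cstarAlgType R) (S : E -> A) : Prop :=
  universal_cstar_algebra (@cuntz_krieger_family E M) S.

Definition cuntz_family (E : finType)
    (A : cstarAlgType R) (S : E -> A) : Prop :=
  (forall e, star (S e) ** S e = cstar1) /\ \sum_e S e ** star (S e) = cstar1.

Definition is_cuntz_algebra (E : finType)
    (A : cstarAlgType R) (S : E -> A) : Prop :=
  universal_cstar_algebra (@cuntz_family E) S.

End UniversalCStarAlgebras.

Section Graph.
Variables (V E : finType) (s t : E -> V).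

Definition edge_adj (e f : E) : nat := (t e == s f).

Definition vertex_adj (v u : V) : nat := #|[set e : E | (s e == v) && (t e == u)]|.

End Graph.

(* [inl e] stands for the symbol S_e and [inr e] for the symbol S_e^*. *)
Definition symbols (E : finType) : finType := (E + E)%type.

Section Words.
Variables (R : realType) (E : finType).

Definition eval_symbol (A : cstarAlgType R) (S : E -> A) (x : symbols E) : A :=
  match x with inl e => S e | inr e => star (S e) end.

Definition eval_word (A : cstarAlgType R) (S : E -> A) (X : seq (symbols E)) : A :=
  \big[cmul/cstar1]_(x <- X) eval_symbol S x.

Definition vertex_proj (V : finType) (s : E -> V) (A : cstarAlgType R)
    (S : E -> A) (v : V) : A :=
  \sum_(f | s f == v) S f ** star (S f).

(* [S] generates O_{A^G} and [T] generates the Cuntz algebra O_{|E|}. *)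
Definition B_words (OA OE : cstarAlgType R) (S : E -> OA) (T : E -> OE)
    (n : nat) : {set (2 * n).-tuple (symbols E)} :=
  [set X : (2 * n).-tuple (symbols E) |
    (eval_word S X != 0) && (eval_word T X == cstar1)].

(* For X in [B_words S T n], v(X) is the unique v with
   [eval_word S X = vertex_proj s S v]. *)
Definition c_coef (V : finType) (s : E -> V) (OA OE : cstarAlgType R)
    (S : E -> OA) (T : E -> OE) (n : nat) (u : V) : nat :=
  if n == 0%N then 1%N
  else #|[set X in B_words S T n | eval_word S X == vertex_proj s S u]|.

End Words.

(* Main.v *)
(** Read a word from left to right with a stack, [S_e^*] pushing [e] and [S_e]
    popping [e].  Since [S_e^* S_f = 0] for [e <> f] and [S_e^* S_e = P_(t e)],
    a word with value 1 in the Cuntz algebra is one that empties the stack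
    without a mismatch, and its value in the Cuntz-Krieger algebra is [P_u]
    exactly when the stack always spells a path of [G] ending at [u], i.e. when
    the word is a closed walk at the root of the tree of paths ending at [u].
    Cutting such a walk at its first return to the root gives the recurrence.

    Two analytic facts are needed.  Projections of a C*-algebra with sum 1 are
    mutually orthogonal; this follows from an elementary form of the fact that
    the unit is an extreme point of the unit ball.  And 1 and the [P_v] do not
    vanish in the universal algebras; for this the relations are represented by
    shift operators on the Hilbert space l^2(E x nat). *)

Require Import Defs.
From HB Require Import structures.
From mathcomp Require Import all_boot all_order all_algebra.
From mathcomp Require Import complex ring.
From mathcomp Require Import boolp classical_sets functions reals topology.
From mathcomp Require Import normedtype sequences.

Set Implicit Arguments.
Unset Strict Implicit.
Unset Printing Implicit Defensive.

(** * Counting balanced words *)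

Section StackWords.
Variables (V E : finType) (s t : E -> V).
Implicit Types (e f : E) (u v : V) (st : seq E) (X : seq (symbols E)).

(** [st] lists the pushed edges still to be popped, the latest first. Only the matching of pushes
    and pops is tested, which is all that the Cuntz relations see. *)
Fixpoint balanced st X : bool :=
  match X with
  | [::] => st == [::]
  | inr e :: X' => balanced (e :: st) X'
  | inl e :: X' => if st is f :: st' then (e == f) && balanced st' X' else false
  end.

(** The vertex at which the next pushed edge must end: a push prolongs the stacked path at its
    start, and the empty stack is the trivial path at the root [u]. *)
Definition top_vertex u st : V := if st is e :: _ then s e else u.

Fixpoint closed_walk u st X : bool :=
  match X with
  | [::] => st == [::]
  | inr e :: X' => (t e == top_vertex u st) && closed_walk u (e :: st) X'
  | inl e :: X' =>
      if st is f :: st' then (e == f) && closed_walk u st' X' else false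
  end.

Lemma closed_walk_balanced u st X : closed_walk u st X -> balanced st X.
Proof.
elim: X st => [|[e|e] X IH] [|f st] //=; do ?[by case/andP=> _ /IH].
by case/andP=> -> /IH.
Qed.

Fixpoint walk_count m u st : nat :=
  if m is m'.+1 then
    (if st is _ :: st' then walk_count m' u st' else 0) +
    \sum_(e | t e == top_vertex u st) walk_count m' u (e :: st)
  else st == [::].

Lemma card_tuple_cons (T : finType) m (P : pred (seq T)) :
  #|[set X : m.+1.-tuple T | P X]| =
  \sum_x #|[set X : m.-tuple T | P (x :: X)]|.
Proof.
rewrite -sum1_card (partition_big (@thead m T) xpredT) //=.
apply: eq_bigr => x _; rewrite sum1_card.
rewrite -[RHS](card_imset _ (f := cons_tuple x)).
  apply: eq_card => X; rewrite [LHS]unfold_in inE.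
  apply/andP/imsetP => [[PX /eqP <-]|[Y]].
    exists (behead_tuple X); last exact: tuple_eta.
    by rewrite inE; move: PX; rewrite {1}(tuple_eta X).
  by rewrite inE => PY ->; rewrite theadE eqxx.
by move=> X Y [/val_inj].
Qed.

Lemma card_closed_walk m u st :
  #|[set X : m.-tuple (symbols E) | closed_walk u st X]| = walk_count m u st.
Proof.
elim: m st => [|m IH] st /=.
  case: eqP => [->|st0]; last first.
    by apply: eq_card0 => X; rewrite inE tuple0 /=; apply/eqP.
  by rewrite (eq_card (B := predT)) ?card_tuple // => X; rewrite inE tuple0.
rewrite card_tuple_cons big_sumType /=; congr (_ + _).
  case: st => [|f st]; first by rewrite big1 // => e _; rewrite cardsE card0.
  rewrite (bigD1 f) //= eqxx IH big1 ?addn0 // => e /negPf -> /=.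
  by rewrite cardsE card0.
rewrite [RHS]big_mkcond; apply: eq_bigr => e _.
by case: eqP => _ /=; rewrite ?IH // cardsE card0.
Qed.

(** Every letter changes the height of the stack by one, and the final height is 0. *)
Lemma walk_count_odd m u st : odd (m + size st) -> walk_count m u st = 0.
Proof.
elim: m st => [|m IH] [|f st] //= om.
  by rewrite big1 // => e _; rewrite IH //= addn1 /= -[m]addn0.
rewrite IH ?add0n; last by move: om; rewrite addnS /= negbK.
by rewrite big1 // => e _; rewrite IH //= addnS.
Qed.

(* A walk leaving from the stack [st' ++ e :: st] is cut at the first time [e]
   is removed; before that it only sees [st'], above the vertex [s e]. *)
Lemma walk_count_cat m u st' e st :
  walk_count m u (st' ++ e :: st) =
  \sum_(j < m) walk_count j (s e) st' * walk_count (m.-1 - j) u st.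
Proof.
elim: m st' => [|m IH] st'; first by rewrite big_ord0; case: st'.
(* Seen from above, [e :: st] acts as an empty stack with root [s e]. *)
have topE : top_vertex u (st' ++ e :: st) = top_vertex (s e) st' by case: st'.
have sumE : \sum_(f | t f == top_vertex (s e) st')
      walk_count m u (f :: st' ++ e :: st) =
    \sum_(j < m) (\sum_(f | t f == top_vertex (s e) st')
      walk_count j (s e) (f :: st')) * walk_count (m - j.+1) u st.
  under eq_bigr => f _ do rewrite -cat_cons IH.
  rewrite exchange_big; apply: eq_bigr => j _; rewrite -big_distrl /=.
  by rewrite -subn1 -subnDA add1n.
(* The term [j = 0] is the walk that pops [e] at once; it survives only if [st'] is empty. *)
rewrite big_ord_recl /= subn0 topE sumE.
case: st' topE sumE => [|f st'] topE sumE /=.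
  by rewrite mul1n; congr (_ + _); apply: eq_bigr => j _; rewrite add0n.
rewrite mul0n add0n IH -big_split /=; apply: eq_bigr => j _.
by rewrite mulnDl /bump /= add1n -subn1 -subnDA add1n.
Qed.

Lemma sum_ord_even (F : nat -> nat) n : (forall j, odd j -> F j = 0) ->
  \sum_(j < (2 * n).+1) F j = \sum_(k < n.+1) F (2 * k).
Proof.
move=> F0; elim: n => [|n IH]; first by rewrite !big_ord_recr !big_ord0.
rewrite [RHS]big_ord_recr /= -IH mulnS !big_ord_recr /=.
by rewrite [F (2 * n).+1]F0 ?addn0 //= mul2n odd_double.
Qed.

Lemma sum_vertex_adj u (F : V -> nat) :
  \sum_(e | t e == u) F (s e) = \sum_v vertex_adj s t v u * F v.
Proof.
rewrite (partition_big s xpredT) //=; apply: eq_bigr => v _.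
rewrite (eq_bigr (fun=> F v)) => [|e /andP[_ /eqP -> //]].
rewrite sum_nat_const /vertex_adj cardsE; congr (_ * _).
by apply: eq_card => e; rewrite !unfold_in andbC.
Qed.

(** The first letter pushes some [e] ending at [u]. Cutting at its pop leaves a walk at [s e], of
    even length, and a walk at [u]; the two letters for [e] account for the passage from [n] to
    [n.+1]. Grouping the edges by source gives [vertex_adj]. *)
Lemma walk_count_rec n u :
  walk_count (2 * n.+1) u [::] =
  \sum_(k < n.+1) walk_count (2 * (n - k)) u [::] *
    \sum_v vertex_adj s t v u * walk_count (2 * k) v [::].
Proof.
have -> : 2 * n.+1 = (2 * n).+2 by rewrite mulnS.
rewrite [LHS]/= add0n.
under eq_bigr => e _.
  (* The summand, unfolded by simplification, is folded back as a stack with nothing above [e]. *)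
  rewrite -[walk_count _ _ _ + _]/(walk_count (2 * n).+1 u ([::] ++ [:: e])).
  rewrite walk_count_cat (sum_ord_even (F := fun j => walk_count j (s e) [::] *
    walk_count (2 * n - j) u [::])); last first.
    by move=> j oj; rewrite walk_count_odd // addn0.
  over.
rewrite exchange_big; apply: eq_bigr => k _; rewrite -big_distrl [LHS]mulnC /=.
by rewrite -mulnBr (sum_vertex_adj _ (fun v => walk_count (2 * k) v [::])).
Qed.

End StackWords.

Import Order.TTheory GRing.Theory Num.Theory.
Import numFieldNormedType.Exports.

Local Open Scope classical_set_scope.
Local Open Scope complex_scope.
Local Open Scope ring_scope.

Local Notation "x ** y" := (cmul x y) (at level 40, left associativity).

(** * Orthogonality of projections with sum 1 *)

(** Bernoulli's inequality for 1 + 1/4, without its constant term; it makes the powers of 5/4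
    unbounded in [two_sided_eq0]. *)
Lemma linear_le_geometric (K : numFieldType) k :
  k%:R / 4 <= (5 / 4) ^+ k :> K.
Proof.
have q4 : 5 / 4 = 1 + 4^-1 :> K by field.
have ge0 : 0 <= 4^-1 :> K by rewrite invr_ge0.
rewrite q4; elim: k => [|k IH]; first by rewrite mul0r expr0.
rewrite exprSr mulrDr mulr1 -natr1 mulrDl lerD // ler_wpM2r //.
by rewrite exprn_ege1 // lerDl.
Qed.

Section CStarBasics.
Variables (R : realType) (A : cstarAlgType R).
Implicit Types x y z p q a : A.

Lemma cmul0x x : 0 ** x = 0.
Proof. by apply: (addrI (0 ** x)); rewrite addr0 -cmulDl addr0. Qed.

Lemma cmulx0 x : x ** 0 = 0.
Proof. by apply: (addrI (x ** 0)); rewrite addr0 -cmulDr addr0. Qed.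

Lemma cmul_suml (J : Type) (r : seq J) (P : pred J) (F : J -> A) x :
  (\sum_(j <- r | P j) F j) ** x = \sum_(j <- r | P j) F j ** x.
Proof.
exact: (big_morph (fun y => y ** x) (fun y z => cmulDl y z x) (cmul0x x)).
Qed.

Lemma cmul_sumr (J : Type) (r : seq J) (P : pred J) (F : J -> A) x :
  x ** (\sum_(j <- r | P j) F j) = \sum_(j <- r | P j) x ** F j.
Proof. exact: (big_morph (cmul x) (cmulDr x) (cmulx0 x)). Qed.

Lemma cmulNx x y : (- x) ** y = - (x ** y).
Proof. by rewrite -scaleN1r -cscaleAl scaleN1r. Qed.

Lemma cmulxN x y : x ** (- y) = - (x ** y).
Proof. by rewrite -scaleN1r -cscaleAr scaleN1r. Qed.

Lemma cmulBl x y z : (x - y) ** z = x ** z - y ** z.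
Proof. by rewrite cmulDl cmulNx. Qed.

Lemma cmulBr x y z : z ** (x - y) = z ** x - z ** y.
Proof. by rewrite cmulDr cmulxN. Qed.

Lemma star0 : star (0 : A) = 0.
Proof. by rewrite -{1}(scale0r (0 : A)) starZ conjC0 scale0r. Qed.

Lemma starN x : star (- x) = - star x.
Proof. by rewrite -scaleN1r starZ rmorphN1 scaleN1r. Qed.

Lemma starB x y : star (x - y) = star x - star y.
Proof. by rewrite starD starN. Qed.

Lemma star1 : star (cstar1 : A) = cstar1.
Proof. by rewrite -[LHS]cmulx1 -{2}(starK cstar1) -starM cmulx1 starK. Qed.

Lemma star_eq0 x : star x ** x = 0 -> x = 0.
Proof.
move=> xx; apply/eqP; rewrite -normr_eq0 -sqrf_eq0 -cstar_identity xx.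
by rewrite normr0.
Qed.

Definition projection p : Prop := p ** p = p /\ star p = p.

(** The C*-identity gives [|p|^2 = |p|], so the norm is 0 or 1. *)
Lemma projection_norm_le1 p : projection p -> `|p| <= 1.
Proof.
move=> [pp sp]; have := cstar_identity p; rewrite sp pp => /eqP.
rewrite expr2 -subr_eq0 -{1}[`|p|]mulr1 -mulrBr mulf_eq0.
by case/orP => [/eqP -> //|]; rewrite subr_eq0 => /eqP <-.
Qed.

Lemma projection_compl p : projection p -> projection (cstar1 - p).
Proof.
move=> [pp sp]; split; last by rewrite starB star1 sp.
by rewrite cmulBl !cmulBr !cmul1x cmulx1 pp subrr subr0.
Qed.

(* The only such [a] is 0 ([two_sided_eq0]): from [|p + z a| <= 1] for
   [z^4 = 1] one gets the same bounds for [b := (3 a + a^3) / 2] and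
   [|a| <= 1/3], while [|b| >= 5/4 |a|]. *)
Definition two_sided p a : Prop :=
  [/\ star a = a, p ** a = a, a ** p = a, `|p + a| <= 1 & `|p - a| <= 1].

Section Corner.
Variables p a : A.
Hypothesis pP : projection p.
Hypothesis aP : two_sided p a.

(** Since [p] acts on [a] as a unit, these are the polynomials of degree at most 3 in [a]. *)
Local Notation cubic c0 c1 c2 c3 :=
  (c0 *: p + c1 *: a + c2 *: (a ** a) + c3 *: (a ** (a ** a))).

Lemma cubicD c0 c1 c2 c3 d0 d1 d2 d3 :
  cubic c0 c1 c2 c3 + cubic d0 d1 d2 d3 =
  cubic (c0 + d0) (c1 + d1) (c2 + d2) (c3 + d3).
Proof.
rewrite !scalerDl addrACA; congr (_ + _); rewrite addrACA; congr (_ + _).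
exact: addrACA.
Qed.

Lemma cubicZ c c0 c1 c2 c3 :
  c *: cubic c0 c1 c2 c3 = cubic (c * c0) (c * c1) (c * c2) (c * c3).
Proof. by rewrite !scalerDr !scalerA. Qed.

Lemma corner_cube (z : R[i]) :
  (p + z *: a) ** ((p + z *: a) ** (p + z *: a)) =
  cubic 1 (3 * z) (3 * z ^+ 2) (z ^+ 3).
Proof.
have [pp _] := pP; have [_ pa ap _ _] := aP.
have paa : p ** (a ** a) = a ** a by rewrite cmulA pa.
have sq : (p + z *: a) ** (p + z *: a) = cubic 1 (2 * z) (z ^+ 2) 0.
  rewrite cmulDl !cmulDr pp -!cscaleAl -!cscaleAr pa ap scalerA.
  rewrite scale1r scale0r addr0 addrA -(addrA p) -scalerDl.
  by congr (_ + _ *: _ + _ *: _); ring.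
rewrite sq scale0r addr0 cmulDl !cmulDr -!cscaleAl -!cscaleAr.
rewrite pp pa ap paa !scalerA.
transitivity (cubic 1 (2 * z) (z ^+ 2) 0 + cubic 0 z (2 * z * z) (z ^+ 2 * z)).
  rewrite !scale0r addr0 add0r mulr1 -!addrA; congr (_ + (_ + (_ + _))).
  by congr (_ + (_ *: _ + _ *: _)); ring.
by rewrite cubicD; congr (_ *: _ + _ *: _ + _ *: _ + _ *: _); ring.
Qed.

(** Here [z] is i or -i, so [star (p + z *: a) ** (p + z *: a)] equals [p + a ** a]. This is the
    mean of the squares of [p + a] and [p - a], and the C*-identity turns its bound into one for
    [p + z *: a]. *)
Lemma corner_norm_i (z : R[i]) : `|z| = 1 -> z ^+ 2 = - 1 -> `|p + z *: a| <= 1.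
Proof.
move=> z1 z2; have [pp sp] := pP; have [sa pa ap np nm] := aP.
have zC : z^* = - z.
  have zz : z * z^* = 1 by rewrite -normCK z1 expr1n.
  have z0 : z != 0 by rewrite -normr_gt0 z1.
  by apply: (mulfI z0); rewrite zz mulrN -expr2 z2 opprK.
have sqE (c : A) : star c = c -> `|c| <= 1 -> `|c ** c| <= 1.
  move=> sc c1; rewrite -{1}sc cstar_identity.
  by rewrite exprn_ile1.
have h1 : `|(p + a) ** (p + a)| <= 1.
  by apply: sqE => //; rewrite starD sp sa.
have h2 : `|(p - a) ** (p - a)| <= 1.
  by apply: sqE => //; rewrite starB sp sa.
rewrite -(@ler_pXn2r _ 2) ?nnegrE // expr1n -cstar_identity.
rewrite starD starZ sp sa zC cmulDl !cmulDr pp -!cscaleAl -!cscaleAr pa ap.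
rewrite scalerA mulNr -expr2 z2 opprK scale1r scaleNr addrA addrK.
have -> : p + a ** a = 2^-1 *: ((p + a) ** (p + a) + (p - a) ** (p - a)).
  rewrite !cmulDl !cmulDr !cmulNx !cmulxN pp pa ap opprK.
  rewrite addrACA [in X in _ *: (X + _)]addrACA subrr addr0.
  rewrite [X in _ *: (_ + X)]addrACA subrr add0r.
  rewrite -!mulr2n -mulrnDl -(scaler_nat 2 (p + a ** a)) scalerA.
  by rewrite mulVf ?scale1r ?pnatr_eq0.
rewrite normrZ ger0_norm ?invr_ge0 // ler_pdivrMl // mulr1.
by rewrite (le_trans (ler_normD _ _)) // -[2]/(1 + 1) lerD.
Qed.

Lemma corner_cube_norm (z : R[i]) : `|p + z *: a| <= 1 ->
  `|cubic 1 (3 * z) (3 * z ^+ 2) (z ^+ 3)| <= 1.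
Proof.
move=> h; rewrite -corner_cube (le_trans (cnormM _ _))// mulr_ile1 //.
by rewrite (le_trans (cnormM _ _))// mulr_ile1.
Qed.

Lemma imaginary_unit_norm : (`|'i : R[i]| = 1) * (`|- 'i : R[i]| = 1).
Proof. by rewrite normrN normCi. Qed.

(** These are the cubes of [p + z *: a] for the four fourth roots of unity [z]. *)
Lemma corner_cubes :
  [/\ `|cubic 1 3 3 1| <= 1, `|cubic 1 (- 3) 3 (- 1)| <= 1,
      `|cubic 1 (3 * 'i) (- 3) (- 'i)| <= 1 &
      `|cubic 1 (- (3 * 'i)) (- 3) 'i| <= 1].
Proof.
have [_ _ _ np nm] := aP.
have i2 : 'i ^+ 2 = - 1 :> R[i] := sqrCi _.
have Ni2 : (- 'i) ^+ 2 = - 1 :> R[i] by rewrite sqrrN.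
split.
- by have := @corner_cube_norm 1; rewrite scale1r !expr1n mulr1 => /(_ np).
- have := @corner_cube_norm (- 1).
  by rewrite scaleN1r mulrN1 sqrrN expr1n mulr1 -signr_odd /= expr1 => /(_ nm).
- have := corner_cube_norm (corner_norm_i imaginary_unit_norm.1 i2).
  by rewrite [_ ^+ 3]exprSr i2 mulrN1 mulN1r.
- have := corner_cube_norm (corner_norm_i imaginary_unit_norm.2 Ni2).
  by rewrite [_ ^+ 3]exprSr Ni2 mulrN1 mulN1r opprK mulrN.
Qed.

(** A discrete Fourier sum: dividing the cube of [p + z *: a] by [z] and adding over the fourth
    roots of unity isolates the linear coefficient, so [12 *: a] is a sum of four elements of norm
    at most 1. *)
Lemma corner_norm_small : `|a| <= 3^-1.
Proof.
have [n1 n2 n3 n4] := corner_cubes.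
have ii : 'i * 'i = - 1 :> R[i] by rewrite -expr2 sqrCi.
have a12 : 12 *: a = (cubic 1 3 3 1 + (- 1) *: cubic 1 (- 3) 3 (- 1)) +
    ((- 'i) *: cubic 1 (3 * 'i) (- 3) (- 'i) +
     'i *: cubic 1 (- (3 * 'i)) (- 3) 'i).
  rewrite !cubicZ !cubicD.
  transitivity (cubic 0 12 0 0); first by rewrite !scale0r !addr0 add0r.
  congr (_ *: _ + _ *: _ + _ *: _ + _ *: _); try by ring.
  - transitivity (6 - 6 * ('i * 'i) : R[i]); last by ring.
    by rewrite ii; ring.
  - transitivity (2 + 2 * ('i * 'i) : R[i]); last by ring.
    by rewrite ii; ring.
have : `|12 *: a| <= 4.
  rewrite a12 (le_trans (ler_normD _ _)) //.
  apply: (@le_trans _ _ ((1 + 1) + (1 + 1))); last first.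
    by rewrite le_eqVlt; apply/orP; left; apply/eqP; ring.
  apply: lerD; rewrite (le_trans (ler_normD _ _)) // lerD // normrZ.
  - by rewrite normrN1 mul1r.
  - by rewrite imaginary_unit_norm.2 mul1r.
  - by rewrite imaginary_unit_norm.1 mul1r.
rewrite normrZ normr_nat -[leRHS]/(4%:R) => h.
rewrite -(@ler_pM2l _ 12%:R) // (le_trans h) //.
by rewrite le_eqVlt; apply/orP; left; apply/eqP; field.
Qed.

Definition corner_grow : A := (3 / 2) *: a + 2^-1 *: (a ** (a ** a)).

(** For [c] equal to 1 or -1, [p + c *: corner_grow] is half the cube of [p + c *: a] plus a quarter
    of each of the cubes of [p + 'i *: a] and [p - 'i *: a]. In this convex combination the
    imaginary cubes cancel the term in [a ** a]. *)
Lemma corner_grow_two_sided : two_sided p corner_grow.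
Proof.
have [sa pa ap np nm] := aP; have [n1 n2 n3 n4] := corner_cubes.
have conv c : p + c *: corner_grow =
    2^-1 *: cubic 1 (c * 3) 3 c +
    4^-1 *: (cubic 1 (3 * 'i) (- 3) (- 'i) + cubic 1 (- (3 * 'i)) (- 3) 'i).
  rewrite cubicD !cubicZ cubicD /corner_grow.
  transitivity (cubic 1 (c * (3 / 2)) 0 (c * 2^-1)).
    by rewrite scale1r scale0r addr0 scalerDr !scalerA addrA.
  by congr (_ *: _ + _ *: _ + _ *: _ + _ *: _); field.
have bound x : `|x| <= 1 ->
    `|2^-1 *: x + 4^-1 *: (cubic 1 (3 * 'i) (- 3) (- 'i) +
       cubic 1 (- (3 * 'i)) (- 3) 'i)| <= 1.
  move=> x1; rewrite (le_trans (ler_normD _ _)) // !normrZ.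
  rewrite !ger0_norm ?invr_ge0 //.
  apply: (@le_trans _ _ (2^-1 * 1 + 4^-1 * (1 + 1))); last first.
    by rewrite le_eqVlt; apply/orP; left; apply/eqP; field.
  rewrite lerD // ler_wpM2l ?invr_ge0 //.
  by rewrite (le_trans (ler_normD _ _)) // lerD.
split.
- rewrite /corner_grow starD !starZ !starM sa rmorphM !fmorphV !rmorph_nat.
  by rewrite cmulA.
- by rewrite /corner_grow cmulDr -!cscaleAr pa (cmulA p a) pa.
- by rewrite /corner_grow cmulDl -!cscaleAl -!cmulA ap.
- rewrite -[corner_grow]scale1r conv.
  by rewrite mul1r; exact: bound.
- rewrite -scaleN1r conv.
  by rewrite mulN1r; exact: bound.
Qed.

(** As [|a| <= 1/3], the cubic term costs at most [|a| / 18], and 3/2 - 1/18 exceeds 5/4 by 7/36. *)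
Lemma corner_grow_norm : 5 / 4 * `|a| <= `|corner_grow|.
Proof.
have aE : (3 / 2) *: a = corner_grow - 2^-1 *: (a ** (a ** a)).
  by rewrite addrK.
have a3 : `|a ** (a ** a)| <= 9^-1 * `|a|.
  rewrite (le_trans (cnormM _ _)) // mulrC ler_wpM2r //.
  rewrite (le_trans (cnormM _ _)) //.
  have -> : 9^-1 = 3^-1 * 3^-1 :> R[i] by rewrite -invfM -natrM.
  by rewrite ler_pM // corner_norm_small.
have := congr1 (fun x => `|x|) aE; rewrite normrZ => aN.
have h : (3 / 2) * `|a| <= `|corner_grow| + 2^-1 * (9^-1 * `|a|).
  have -> : 3 / 2 = `|3 / 2| :> R[i] by rewrite ger0_norm // divr_ge0.
  rewrite aN (le_trans (ler_normB _ _)) // lerD // normrZ.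
  by rewrite ger0_norm ?invr_ge0 // ler_wpM2l ?invr_ge0.
rewrite -(lerD2r (2^-1 * (9^-1 * `|a|))) (le_trans _ h) //.
rewrite mulrA -mulrDl ler_wpM2r //.
have -> : (3 / 2 : R[i]) = 5 / 4 + 2^-1 * 9^-1 + 7 / 36 by field.
by rewrite lerDl divr_ge0.
Qed.

End Corner.

Lemma two_sided_eq0 p a : projection p -> two_sided p a -> a = 0.
Proof.
move=> pP aP.
(* Growing [k] times stays among the two-sided elements and multiplies the norm by at least the
   [k]-th power of 5/4. *)
have bound k : forall b, two_sided p b -> (5 / 4) ^+ k * `|b| <= 1.
  elim: k => [|k IH] b bP.
    rewrite mul1r (le_trans (corner_norm_small pP bP)) //.
    by rewrite invf_le1 ?ler1n.
  rewrite exprSr -mulrA (le_trans _ (IH _ (corner_grow_two_sided pP bP))) //.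
  by rewrite ler_wpM2l ?exprn_ge0 ?divr_ge0 // (corner_grow_norm pP bP).
have lin k : k%:R * `|a| <= 4.
  have h := linear_le_geometric R[i] k.
  rewrite -[4]mulr1 -ler_pdivrMl // mulrA [_^-1 * _]mulrC.
  by rewrite (le_trans _ (bound k _ aP)) // ler_wpM2r.
apply/eqP; rewrite -normr_eq0; apply/negPn/negP => na0.
have a0 : 0 < `|a| by rewrite lt_def na0 /=.
(* Norms take values in [R[i]], so the archimedean property is applied to the real part. *)
have aR : (complex.Re `|a|)%:C = `|a| by rewrite RRe_real ?normr_real.
have aR0 : 0 < complex.Re `|a| by rewrite -ltcR aR.
have := Num.Theory.archi_boundP (ltW (divr_gt0 (ltr0n R 4) aR0)).
set n := Num.bound _; rewrite ltr_pdivrMr // => h4.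
have := lin n; rewrite -aR -[n%:R](rmorph_nat (real_complex R)).
rewrite -[4](rmorph_nat (real_complex R)) -rmorphM lecR => /(lt_le_trans h4).
by rewrite ltxx.
Qed.

End CStarBasics.

Section OrthogonalProjections.
Variables (R : realType) (A : cstarAlgType R) (J : finType) (q : J -> A).
Hypothesis qP : forall j, projection (q j).
Hypothesis q_sum : \sum_j q j = cstar1.

(** Everything is compressed to the corner of [p = q i]. The elements [x k] sum to [p] and
    [x i = p], so those with [k != i] sum to 0. Hence [p + x j / N] and [p - x j / N] are both means
    of [N] contractions, and [x j / N] is two-sided, thus 0. Finally [x j] is
    [star (q j ** p) ** (q j ** p)]. *)
Lemma projections_sum1_orth i j : i != j -> q i ** q j = 0.
Proof.
move=> ij; set p := q i; have [pp sp] := qP i; rewrite -/p in pp sp.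
pose x k := p ** (q k ** p).
have sx k : star (x k) = x k by rewrite /x !starM sp (qP k).2 cmulA.
have px k : p ** x k = x k by rewrite /x !cmulA pp.
have xp k : x k ** p = x k by rewrite /x -!cmulA pp.
have p1 : `|p| <= 1 by apply: projection_norm_le1; exact: qP.
have pxk k : `|p - x k| <= 1.
  have -> : p - x k = p ** ((cstar1 - q k) ** p).
    by rewrite cmulBl cmul1x cmulBr pp.
  rewrite (le_trans (cnormM _ _)) // mulr_ile1 //.
  rewrite (le_trans (cnormM _ _)) // mulr_ile1 //.
  exact/projection_norm_le1/projection_compl.
have xsum : x j = - \sum_(k | (k != i) && (k != j)) x k.
  apply/eqP; rewrite -addr_eq0; apply/eqP/(addrI p); rewrite addr0.
  have xi : p = x i by rewrite /x -/p pp pp.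
  have : \sum_k x k = p by rewrite -cmul_sumr -cmul_suml q_sum cmul1x pp.
  by rewrite (bigD1 i) //= (bigD1 j) 1?eq_sym //= -xi.
pose N := #|J|; have N0 : (0 < N)%N by apply/card_gt0P; exists i.
have sumN (F : J -> A) : (forall k, `|F k| <= 1) -> `|\sum_k F k| <= N%:R.
  move=> F1; rewrite (le_trans (ler_norm_sum _ _ _)) //.
  by rewrite -[N%:R]sumr_const ler_sum.
(* Here [x j] is traded for the [- x k] with [k] different from [i] and [j], at most one of them for
   each copy of [p]. *)
have Nplus : `|p *+ N + x j| <= N%:R.
  have -> : p *+ N + x j =
      \sum_k (if (k != i) && (k != j) then p - x k else p).
    rewrite xsum -sumr_const -sumrN [X in _ + X]big_mkcond -big_split /=.
    by apply: eq_bigr => k _; case: ifP; rewrite ?addr0.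
  by apply: sumN => k; case: ifP.
have Nminus : `|p *+ N - x j| <= N%:R.
  have -> : p *+ N - x j = \sum_k (if k == j then p - x k else p).
    rewrite -sumr_const -[x j](big_pred1_eq +%R j x) -sumrN.
    rewrite [X in _ + X]big_mkcond -big_split /=.
    by apply: eq_bigr => k _; case: ifP; rewrite ?addr0.
  by apply: sumN => k; case: ifP.
have NR0 : 0 < N%:R :> R[i] by rewrite ltr0n.
have scale_le y : `|p *+ N + y| <= N%:R -> `|p + N%:R^-1 *: y| <= 1.
  move=> h; have -> : p + N%:R^-1 *: y = N%:R^-1 *: (p *+ N + y).
    by rewrite scalerDr -(scaler_nat N p) scalerA mulVf ?scale1r ?gt_eqF.
  by rewrite normrZ normfV normr_nat ler_pdivrMl // mulr1.
have : N%:R^-1 *: x j = 0.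
  apply: (@two_sided_eq0 _ _ p); first exact: qP.
  split.
  - by rewrite starZ sx fmorphV rmorph_nat.
  - by rewrite -cscaleAr px.
  - by rewrite -cscaleAl xp.
  - exact: scale_le.
  - by rewrite -scalerN; exact: scale_le.
move/eqP; rewrite scaler_eq0 invr_eq0 gt_eqF //= => /eqP xj0.
have qp0 : q j ** p = 0.
  apply: star_eq0; rewrite starM sp (qP j).2 cmulA -(cmulA p) (qP j).1.
  by rewrite -cmulA.
by rewrite -[LHS]starK starM sp (qP j).2 qp0 star0.
Qed.

End OrthogonalProjections.

(** * Partial isometries whose range projections sum to 1 *)

Section RangeProjections.
Variables (R : realType) (A : cstarAlgType R) (E : finType) (S : E -> A).
Hypothesis S_pi : forall e, partial_isometry (S e).
Hypothesis S_sum : \sum_f S f ** star (S f) = cstar1.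

Lemma range_projection e : projection (S e ** star (S e)).
Proof. by split; [rewrite cmulA S_pi|rewrite starM starK]. Qed.

Lemma star_partial_isometry e : star (S e) ** (S e ** star (S e)) = star (S e).
Proof. by rewrite -[in RHS](S_pi e) !starM starK. Qed.

(** The vanishing product of the two range projections is multiplied by [star (S e)] on the left and
    by [S f] on the right. *)
Lemma star_orth e f : e != f -> star (S e) ** S f = 0.
Proof.
move=> ef; have := projections_sum1_orth range_projection S_sum ef.
move=> /(congr1 (fun x => star (S e) ** x ** S f)).
rewrite !cmulx0 cmul0x => <-; rewrite !cmulA.
rewrite -(cmulA (star (S e))) star_partial_isometry -!cmulA.
by rewrite (cmulA (S f)) S_pi.
Qed.

(** The part of a word already read, in reduced form; the top of the stack is rightmost, next to the
    unread letters. The start [x0] will be 1 in the Cuntz algebra and a vertex projection in the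
    Cuntz-Krieger algebra. *)
Definition stack_word (x0 : A) (st : seq E) : A :=
  foldr (fun e x => x ** star (S e)) x0 st.

Lemma eval_word_nil : eval_word S [::] = cstar1.
Proof. exact: big_nil. Qed.

Lemma eval_word_cons x X :
  eval_word S (x :: X) = eval_symbol S x ** eval_word S X.
Proof. exact: big_cons. Qed.

End RangeProjections.

(** * Evaluation of words *)

Section CuntzWords.
Variables (R : realType) (A : cstarAlgType R) (E : finType) (T : E -> A).
Hypothesis T_cuntz : cuntz_family T.
Hypothesis E_ge2 : (2 <= #|E|)%N.
Hypothesis A_neq0 : (cstar1 : A) != 0.

Lemma cuntz_partial_isometry e : partial_isometry (T e).
Proof. by rewrite /partial_isometry -cmulA T_cuntz.1 cmulx1. Qed.

Lemma cuntz_orth e f : e != f -> star (T e) ** T f = 0.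
Proof. exact: star_orth cuntz_partial_isometry T_cuntz.2 _ _. Qed.

Lemma exists_neq (e : E) : exists f, f != e.
Proof.
have /card_gt0P[f] : (0 < #|predC1 e|)%N.
  by rewrite cardC1; case: #|E| E_ge2 => [|[]].
by rewrite inE; exists f.
Qed.

(** Right multiplication by [T f] with [f != e] kills the left side, whereas 1 would give [T f].
    This is where a second edge is used. *)
Lemma cuntz_mul_star_neq1 x e : x ** star (T e) != cstar1.
Proof.
have [f fe] := exists_neq e; apply: contra_neq A_neq0 => xe.
rewrite -(T_cuntz.1 f) -[T f]cmul1x -xe -[x ** _ ** _]cmulA.
by rewrite cuntz_orth 1?eq_sym // !cmulx0.
Qed.

Lemma cuntz_mul_neq1 x e : T e ** x != cstar1.
Proof.
apply: contra_neq (cuntz_mul_star_neq1 (star x) e) => /(congr1 star).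
by rewrite starM star1.
Qed.

(** Matched pairs cancel, so the product is invariant while reading. None of the three failures
    gives 1: a mismatch gives 0, a leftover stack [x ** star (T e)], a pop from the empty stack
    [T e ** x]. *)
Lemma stack_word_balanced st X :
  balanced st X = (stack_word T cstar1 st ** eval_word T X == cstar1).
Proof.
elim: X st => [|[e|e] X IH] st /=.
- rewrite eval_word_nil cmulx1; case: st => [|f st] /=; first by rewrite !eqxx.
  by rewrite (negPf (cuntz_mul_star_neq1 _ _)).
- rewrite eval_word_cons /=; case: st => [|f st] /=.
    by rewrite cmul1x (negPf (cuntz_mul_neq1 _ _)).
  rewrite cmulA -(cmulA _ (star _)); have [->|ef] /= := eqVneq e f.
    by rewrite T_cuntz.1 cmulx1 IH.
  rewrite eq_sym in ef; rewrite cuntz_orth // cmulx0 cmul0x eq_sym.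
  exact/esym/negbTE.
- by rewrite eval_word_cons IH /= cmulA.
Qed.

Lemma eval_word_balanced X : (eval_word T X == cstar1) = balanced [::] X.
Proof. by rewrite stack_word_balanced /= cmul1x. Qed.

End CuntzWords.

Section CuntzKriegerWords.
Variables (R : realType) (A : cstarAlgType R) (V E : finType) (s t : E -> V).
Variable S : E -> A.
Hypothesis S_CK : cuntz_krieger_family (edge_adj s t) S.

Local Notation Pv := (vertex_proj s S).

Let S_pi : forall e, partial_isometry (S e).
Proof. by case: S_CK. Qed.

Let S_sum : \sum_f S f ** star (S f) = cstar1.
Proof. by case: S_CK. Qed.

Lemma CK_orth e f : e != f -> star (S e) ** S f = 0.
Proof. exact: star_orth S_pi S_sum _ _. Qed.

Lemma CK_source e : star (S e) ** S e = Pv (t e).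
Proof.
have [_ _ ->] := S_CK; rewrite /vertex_proj [RHS]big_mkcond.
by apply: eq_bigr => f _; rewrite /edge_adj eq_sym; case: eqP.
Qed.

Lemma star_mul_vertex_proj e v :
  star (S e) ** Pv v = if s e == v then star (S e) else 0.
Proof.
rewrite /vertex_proj cmul_sumr; case: ifP => sv.
  rewrite (bigD1 e) //= big1 ?addr0 ?star_partial_isometry // => f.
  by case/andP=> _ fe; rewrite cmulA CK_orth 1?eq_sym // cmul0x.
rewrite big1 // => f sf; rewrite cmulA CK_orth ?cmul0x //.
by apply: contraFneq sv => ->.
Qed.

Lemma vertex_proj_mul u v : Pv u ** Pv v = if u == v then Pv u else 0.
Proof.
rewrite {1}/vertex_proj cmul_suml.
rewrite (eq_bigr (fun f => if u == v then S f ** star (S f) else 0)).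
  by case: eqP => // _; rewrite big1.
move=> f /eqP <-; rewrite -cmulA star_mul_vertex_proj.
by case: ifP; rewrite ?cmulx0.
Qed.

Lemma vertex_proj_sum : \sum_v Pv v = cstar1.
Proof. by rewrite -S_sum (partition_big s xpredT). Qed.

(** By [CK_source], the projection [Pv (t e)] absorbs into [star (S e)]. This is what kills the push
    of an edge that does not end at the current vertex. *)
Lemma vertex_proj_mul_star e v :
  Pv v ** star (S e) = if t e == v then star (S e) else 0.
Proof.
have Ste : Pv (t e) ** star (S e) = star (S e).
  by rewrite -CK_source -cmulA star_partial_isometry.
rewrite -{1}Ste cmulA vertex_proj_mul eq_sym.
by case: eqP => [<-|_]; rewrite ?Ste ?cmul0x.
Qed.

Fixpoint stack_path (u : V) (st : seq E) : bool :=
  if st is e :: st' then (t e == top_vertex s u st') && stack_path u st'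
  else true.

Lemma stack_word_top u st :
  stack_word S (Pv u) st ** Pv (top_vertex s u st) = stack_word S (Pv u) st.
Proof.
case: st => [|e st] /=; first by rewrite vertex_proj_mul eqxx.
by rewrite -cmulA star_mul_vertex_proj eqxx.
Qed.

(** A matching pop produces the projection at the top vertex of the remaining stack, which
    [stack_word_top] absorbs. A push either prolongs the path or, by [vertex_proj_mul_star], gives
    0. *)
Lemma stack_word_closed_walk u st X : stack_path u st -> balanced st X ->
  stack_word S (Pv u) st ** eval_word S X =
  if closed_walk s t u st X then Pv u else 0.
Proof.
elim: X st => [|[e|e] X IH] st path_st /=.
- by move=> /eqP ->; rewrite eqxx eval_word_nil cmulx1.
- case: st path_st => [//|f st] /= /andP[tf path_st] /andP[/eqP -> bX].
  rewrite eqxx /= -(IH _ path_st bX) eval_word_cons /= cmulA.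
  rewrite -(cmulA _ (star _)).
  by rewrite CK_source (eqP tf) stack_word_top.
- move=> bX; rewrite eval_word_cons /= cmulA.
  case te: (t e == top_vertex s u st) => /=.
    by rewrite -IH //= te.
  rewrite -stack_word_top -(cmulA _ (Pv _)) vertex_proj_mul_star te.
  by rewrite cmulx0 cmul0x.
Qed.

Lemma eval_word_closed_walk u X : balanced [::] X ->
  Pv u ** eval_word S X = if closed_walk s t u [::] X then Pv u else 0.
Proof. exact: (@stack_word_closed_walk u [::]). Qed.

(** By [vertex_proj_sum], the value of a word is the sum of its products with all [Pv v]. The word
    is non-empty because the empty one is a closed walk at every vertex, with value 1. *)
Lemma closed_walk_eval_word u x X : Pv u != 0 -> balanced [::] (x :: X) ->
  (eval_word S (x :: X) == Pv u) = closed_walk s t u [::] (x :: X).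
Proof.
move=> Pu bX; apply/eqP/idP => [XE|walk].
  have := eval_word_closed_walk u bX; rewrite XE vertex_proj_mul eqxx.
  by case: ifP => // _ /eqP; rewrite (negPf Pu).
rewrite -[LHS]cmul1x -vertex_proj_sum cmul_suml (bigD1 u) //= big1.
  by rewrite addr0 eval_word_closed_walk // walk.
move=> v vu; rewrite eval_word_closed_walk //.
(* On the empty stack the first letter is a push; its edge ends at [u], so the word is no walk at
   [v]. *)
case: x bX walk => //= e _ /andP[/eqP -> _].
by rewrite eq_sym (negPf vu).
Qed.

End CuntzKriegerWords.

(** * Bounded operators on a Hilbert space *)

(** The Cauchy property of the image of [F] under [f], with one set and a norm bound in place of
    entourages. *)
Definition cauchy_along (K : numFieldType) (V : normedModType K) (T : Type)
    (F : set_system T) (f : T -> V) : Prop :=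
  forall e : K, 0 < e ->
    exists2 A, F A & forall x y, A x -> A y -> `|f x - f y| <= e.

Lemma cauchy_along_cvg (K : numFieldType) (V : completeNormedModType K)
    (T : Type) (F : set_system T) (FF : ProperFilter F) (f : T -> V) :
  cauchy_along F f -> exists l : V, f @ F --> l.
Proof.
move=> Ff; apply/cvg_ex; apply: cauchy_cvg; apply/cauchy_ballP => e e0.
have [A FA Af] := Ff (e / 2) (divr_gt0 e0 (ltr0Sn _ _)).
exists (f @` A, f @` A) => /=.
  by split; apply: (@filterS _ F _ A) => // x Ax; exists x.
move=> [_ _] /= [[x Ax <-] [y Ay <-]]; rewrite -ball_normE /=.
by rewrite (le_lt_trans (Af _ _ Ax Ay)) // ltr_pdivrMr // ltr_pMr // ltr1n.
Qed.

Lemma cauchy_along_id (K : numFieldType) (V : normedModType K)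
    (F : set_system V) (FF : ProperFilter F) : cauchy F -> cauchy_along F id.
Proof.
move=> /cauchy_ballP cF e e0; have [[A B] /= [FA FB] AB] := cF e e0.
exists (A `&` B); first exact: filterI.
move=> x y [Ax _] [_ By]; have := AB (x, y) (conj Ax By).
by rewrite -ball_normE /= => /ltW.
Qed.

Lemma cauchy_along_dist (K : numFieldType) (V : normedModType K) (T : Type)
    (F : set_system T) (FF : ProperFilter F) (f : T -> V) (l : V) (A : set T)
    (e : K) (t : T) :
  f @ F --> l -> F A -> 0 <= e -> (forall x, A x -> `|f t - f x| <= e) ->
  `|f t - l| <= e.
Proof.
move=> fl FA e0 Ae; apply/ler_addgt0Pr => d d0.
have /cvgrPdist_le /(_ d d0) Fd := fl.
have [x [Ax xd]] := filter_ex (filterI FA Fd).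
rewrite -(subrKA (f x)) (le_trans (ler_normD _ _))// lerD//; first exact: Ae.
by rewrite distrC.
Qed.

HB.mixin Record isHilbert (R : realType) H of CompleteNormedModule R[i] H := {
  ip : H -> H -> R[i];
  ipDl : forall x y z, ip (x + y) z = ip x z + ip y z;
  ipZl : forall a x y, ip (a *: x) y = a * ip x y;
  ipC : forall x y, ip y x = (ip x y)^*;
  ip_norm : forall x, ip x x = `|x| ^+ 2
}.

#[short(type="hilbertType")]
HB.structure Definition Hilbert (R : realType) :=
  {H of isHilbert R H & CompleteNormedModule R[i] H}.

(** * Sesquilinear forms and their norms *)

Section PreHilbert.
Variables (C : numClosedFieldType) (H : lmodType C) (ip : H -> H -> C).
Hypothesis ipDl : forall x y z, ip (x + y) z = ip x z + ip y z.
Hypothesis ipZl : forall a x y, ip (a *: x) y = a * ip x y.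
Hypothesis ipC : forall x y, ip y x = (ip x y)^*.
Hypothesis ip_ge0 : forall x, 0 <= ip x x.
Hypothesis ip_eq0 : forall x, ip x x = 0 -> x = 0.

(** The form is abstract in order to serve [psum], [l2_ip] and the inner product of a Hilbert space
    alike. *)
Lemma form_Dr x y z : ip x (y + z) = ip x y + ip x z.
Proof. by rewrite ipC ipDl rmorphD /= -!ipC. Qed.

Lemma form_Zr a x y : ip x (a *: y) = a^* * ip x y.
Proof. by rewrite ipC ipZl rmorphM /= -ipC. Qed.

Lemma form_0l y : ip 0 y = 0.
Proof. by rewrite -(scale0r 0) ipZl mul0r. Qed.

Lemma form_CauchySchwarz x y : `|ip x y| ^+ 2 <= ip x x * ip y y.
Proof.
have [->|y0] := eqVneq y 0.
  by rewrite form_0l mulr0 ipC form_0l conjC0 normr0 expr0n.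
have yy0 : 0 < ip y y.
  by rewrite lt_def ip_ge0 andbT; apply: contraNneq y0 => /ip_eq0 ->.
have yyC : (ip y y)^* = ip y y by rewrite -ipC.
(* With this coefficient [x - c *: y] is orthogonal to [y]; positivity of the form there is the
   claim. *)
pose c := ip x y / ip y y.
have := ip_ge0 (x + (- c) *: y).
rewrite ipDl !form_Dr !ipZl !form_Zr (ipC x y) rmorphN rmorphM.
rewrite /= fmorphV /= yyC !mulNr [in X in _ + (_ + X)]mulrN opprK.
have -> : c * ((ip x y)^* / ip y y * ip y y) = c * (ip x y)^*.
  by rewrite divfK ?gt_eqF.
rewrite addNr addr0 mulrAC -normCKC subr_ge0.
by rewrite ler_pdivrMr.
Qed.

Definition form_norm x := sqrtC (ip x x).

Lemma form_norm_ge0 x : 0 <= form_norm x.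
Proof. by rewrite sqrtC_ge0. Qed.

Lemma form_norm_sq x : form_norm x ^+ 2 = ip x x.
Proof. exact: sqrtCK. Qed.

Lemma form_normD x y : form_norm (x + y) <= form_norm x + form_norm y.
Proof.
rewrite -(@ler_pXn2r _ 2) ?nnegrE ?addr_ge0 ?form_norm_ge0 //.
rewrite sqrrD !form_norm_sq ipDl !form_Dr addrA lerD2r -addrA lerD2l.
rewrite (ipC x y).
have CS : `|ip x y| <= form_norm x * form_norm y.
  rewrite -(@ler_pXn2r _ 2) ?nnegrE ?mulr_ge0 ?form_norm_ge0 //.
  by rewrite exprMn !form_norm_sq form_CauchySchwarz.
apply: (@le_trans _ _ (`|ip x y| *+ 2)); last by rewrite lerMn2r.
apply: le_trans (real_ler_norm _) _.
  by rewrite CrealE rmorphD /= conjCK addrC.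
by rewrite (le_trans (ler_normD _ _))// norm_conjC -mulr2n.
Qed.

Lemma form_normZ a x : form_norm (a *: x) = `|a| * form_norm x.
Proof.
rewrite /form_norm ipZl form_Zr mulrA -normCK sqrtCM ?nnegrE ?exprn_ge0//.
by rewrite exprCK.
Qed.

Lemma form_norm_eq0 x : form_norm x = 0 -> x = 0.
Proof. by move/eqP; rewrite sqrtC_eq0 => /eqP/ip_eq0. Qed.

End PreHilbert.

Section HilbertTheory.
Variables (R : realType) (H : hilbertType R).
Implicit Types x y z : H.

Lemma ipDr x y z : ip x (y + z) = ip x y + ip x z.
Proof. exact: (form_Dr (@ipDl R H) (@ipC R H)). Qed.

Lemma ipZr a x y : ip x (a *: y) = a^* * ip x y.
Proof. exact: (form_Zr (@ipZl R H) (@ipC R H)). Qed.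

Lemma ipBl x y z : ip (x - y) z = ip x z - ip y z.
Proof. by rewrite -scaleN1r ipDl ipZl mulN1r. Qed.

Lemma ipBr x y z : ip x (y - z) = ip x y - ip x z.
Proof. by rewrite ipC ipBl rmorphB /= -!ipC. Qed.

Lemma ip_CauchySchwarz x y : `|ip x y| <= `|x| * `|y|.
Proof.
have := form_CauchySchwarz (@ipDl R H) (@ipZl R H) (@ipC R H) _ _ x y.
rewrite !ip_norm -exprMn ler_pXn2r ?nnegrE ?mulr_ge0 //; apply=> z.
  by rewrite ip_norm exprn_ge0.
by rewrite ip_norm => /eqP; rewrite expf_eq0 /= normr_eq0 => /eqP.
Qed.

Lemma ip_injr x y : (forall z, ip z x = ip z y) -> x = y.
Proof.
move=> xy; apply/eqP; rewrite -subr_eq0 -normr_eq0 -sqrf_eq0 -ip_norm.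
by rewrite ipBr xy subrr.
Qed.

Lemma ip_injl x y : (forall z, ip x z = ip y z) -> x = y.
Proof. by move=> xy; apply: ip_injr => z; rewrite ipC xy -ipC. Qed.

End HilbertTheory.

Section BoundedOperators.
Variables (R : realType) (H : hilbertType R).

Definition adjoint_pair (T T' : H -> H) : Prop :=
  forall x y, ip (T x) y = ip x (T' y).

Definition norm_bound (T : H -> H) (M : R[i]) : Prop :=
  forall x, `|T x| <= M * `|x|.

(* An operator with an adjoint is automatically linear ([bopD], [bopZ]). *)
Definition bounded_adjointable : pred (H -> H) :=
  fun T => `[< (exists T', adjoint_pair T T') /\ (exists M, norm_bound T M) >].

Lemma adjoint_pair_sym T T' : adjoint_pair T T' -> adjoint_pair T' T.
Proof. by move=> TT' x y; rewrite ipC -TT' -ipC. Qed.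

Lemma adjoint_pair_uniq T T1 T2 :
  adjoint_pair T T1 -> adjoint_pair T T2 -> T1 = T2.
Proof.
by move=> T1P T2P; apply/funext => y; apply: ip_injr => x; rewrite -T1P -T2P.
Qed.

Lemma adjoint_pair_lin a S S' T T' : adjoint_pair S S' -> adjoint_pair T T' ->
  adjoint_pair (a *: S + T) (a^* *: S' + T').
Proof.
move=> SS' TT' x y; rewrite /GRing.add /GRing.scale /= ipDl ipDr ipZl ipZr.
by rewrite conjCK SS' TT'.
Qed.

Lemma adjoint_pair_comp S S' T T' : adjoint_pair S S' -> adjoint_pair T T' ->
  adjoint_pair (S \o T) (T' \o S').
Proof. by move=> SS' TT' x y; rewrite /= SS' TT'. Qed.

Lemma norm_bound_lin a S M T N : norm_bound S M -> norm_bound T N ->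
  norm_bound (a *: S + T) (`|a| * M + N).
Proof.
move=> SM TN x; rewrite /GRing.add /GRing.scale /=.
rewrite (le_trans (ler_normD _ _))// mulrDl lerD// normrZ -mulrA.
by rewrite ler_wpM2l.
Qed.

(** The square of [|T' y|] is [ip (T (T' y)) y], hence at most [M * |T' y| * |y|]. *)
Lemma norm_bound_adjoint T T' M : adjoint_pair T T' -> 0 <= M ->
  norm_bound T M -> norm_bound T' M.
Proof.
move=> TT' M0 TM y; have [->|y0] := eqVneq (T' y) 0.
  by rewrite normr0 mulr_ge0.
rewrite -(@ler_pM2l _ `|T' y|) ?normr_gt0 // -expr2 -ip_norm -TT'.
rewrite -[leLHS]ger0_norm; last by rewrite TT' ip_norm exprn_ge0.
rewrite (le_trans (ip_CauchySchwarz _ _))// mulrA ler_wpM2r //.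
by rewrite mulrC; exact: TM.
Qed.

Lemma bounded_adjointable_submod : submod_closed bounded_adjointable.
Proof.
split.
  apply/asboolP; split.
    exists 0 => x y; change (ip (0 : H) y = ip x (0 : H)).
    by rewrite -(scale0r (0 : H)) ipZl ipZr conjC0 !mul0r.
  by exists 0 => x; rewrite mul0r normr0.
move=> a S T /asboolP[[S' SS'] [M SM]] /asboolP[[T' TT'] [N TN]].
apply/asboolP; split; first by eexists; exact: adjoint_pair_lin SS' TT'.
by eexists; exact: norm_bound_lin SM TN.
Qed.

HB.instance Definition _ :=
  GRing.isSubmodClosed.Build _ _ bounded_adjointable bounded_adjointable_submod.

Record bop := Bop {
  bop_fun :> H -> H;
  bop_prop : bop_fun \in bounded_adjointable }.

HB.instance Definition _ := [isSub for bop_fun].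
HB.instance Definition _ := [Choice of bop by <:].
HB.instance Definition _ := [SubChoice_isSubLmodule of bop by <:].

End BoundedOperators.

(** * The C*-algebra of bounded adjointable operators *)

Section BoundedOperatorNorm.
Variables (R : realType) (H : hilbertType R).
Implicit Types S T : bop H.

Lemma bopP T :
  (exists T' : H -> H, adjoint_pair T T') /\ (exists M, norm_bound T M).
Proof. exact/asboolP/bop_prop. Qed.

Lemma bop_ext S T : (forall x, S x = T x) -> S = T.
Proof. by move=> ST; apply: val_inj; apply/funext. Qed.

Lemma bopDE S T x : (S + T) x = S x + T x. Proof. by []. Qed.
Lemma bopZE a T x : (a *: T) x = a *: T x. Proof. by []. Qed.
Lemma bopBE S T x : (S - T) x = S x - T x. Proof. by []. Qed.
Lemma bop0E x : (0 : bop H) x = 0. Proof. by []. Qed.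

Lemma bopD T x y : T (x + y) = T x + T y.
Proof.
have [[T' TT'] _] := bopP T.
by apply: ip_injl => z; rewrite ipDl !TT' ipDl.
Qed.

Lemma bopZ T a x : T (a *: x) = a *: T x.
Proof.
have [[T' TT'] _] := bopP T.
by apply: ip_injl => z; rewrite ipZl !TT' ipZl.
Qed.

(** The supremum is formed in [R] and then embedded, because norms take values in the partially
    ordered field [R[i]]. *)
Definition opnorm T : R[i] :=
  (sup [set complex.Re `|T x| | x in [set x | `|x| <= 1]])%:C.

Lemma Re_normK (x : H) : (complex.Re `|x|)%:C = `|x|.
Proof. by rewrite RRe_real// normr_real. Qed.

Lemma opnorm_le T M : 0 <= M -> norm_bound T M -> opnorm T <= M.
Proof.
move=> M0 TM; have MR : (complex.Re M)%:C = M by rewrite RRe_real ?ger0_real.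
rewrite -MR lecR; apply: ge_sup => [|_ [x /= x1 <-]].
  by exists (complex.Re `|T 0|); exists 0 => //=; rewrite normr0.
rewrite -lecR MR Re_normK (le_trans (TM x))//.
by rewrite -[leRHS]mulr1 ler_wpM2l.
Qed.

Lemma opnorm_sup T (x : H) : `|x| <= 1 -> `|T x| <= opnorm T.
Proof.
move=> x1; rewrite -Re_normK lecR; apply: ub_le_sup; last by exists x.
have [_ [M TM]] := bopP T; exists (complex.Re `|M|) => _ [y /= y1 <-].
have MR : (complex.Re `|M|)%:C = `|M| by rewrite RRe_real ?normr_real.
rewrite -lecR Re_normK MR (le_trans (TM y))//.
have MMy : 0 <= M * `|y| by rewrite (le_trans _ (TM y)).
rewrite -[leLHS]ger0_norm // normrM normr_id -[leRHS]mulr1.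
by rewrite ler_wpM2l.
Qed.

Lemma opnorm_ge0 T : 0 <= opnorm T.
Proof. by rewrite (le_trans _ (@opnorm_sup T 0 _))// normr0. Qed.

Lemma opnorm_bound T : norm_bound T (opnorm T).
Proof.
move=> x; have [->|x0] := eqVneq x 0.
  by rewrite -(scale0r (0 : H)) bopZ !scale0r normr0 mulr0.
have nx0 : 0 < `|x| by rewrite normr_gt0.
have := @opnorm_sup T (`|x|^-1 *: x).
rewrite bopZ !normrZ normfV normr_id mulVf ?gt_eqF// => /(_ (lexx _)).
by rewrite ler_pdivrMl // mulrC.
Qed.

Lemma opnormD S T : opnorm (S + T) <= opnorm S + opnorm T.
Proof.
apply: opnorm_le => [|x]; first by rewrite addr_ge0 ?opnorm_ge0.
by rewrite bopDE (le_trans (ler_normD _ _))// mulrDl lerD// opnorm_bound.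
Qed.

Lemma opnormZ a T : opnorm (a *: T) = `|a| * opnorm T.
Proof.
have le b S : opnorm (b *: S) <= `|b| * opnorm S.
  apply: opnorm_le => [|x]; first by rewrite mulr_ge0 ?opnorm_ge0.
  by rewrite bopZE normrZ -mulrA ler_wpM2l// opnorm_bound.
have [->|a0] := eqVneq a 0.
  by apply/le_anti; rewrite le normr0 mul0r opnorm_ge0.
apply/le_anti; rewrite le -ler_pdivlMl ?normr_gt0// -normfV.
by rewrite (le_trans _ (le _ _))// scalerA mulVf// scale1r.
Qed.

Lemma opnorm_eq0 T : opnorm T = 0 -> T = 0.
Proof.
move=> T0; apply: bop_ext => x; apply/eqP; rewrite bop0E -normr_le0.
by have := opnorm_bound T x; rewrite T0 mul0r.
Qed.

HB.instance Definition _ :=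
  Lmodule_isNormed.Build R[i] (bop H) opnormD opnormZ opnorm_eq0.

Lemma bop_norm_le T M : 0 <= M -> norm_bound T M -> `|T| <= M.
Proof. exact: opnorm_le. Qed.

Lemma bop_bound T x : `|T x| <= `|T| * `|x|.
Proof. exact: opnorm_bound. Qed.

Definition bop_adj_fun T : H -> H := projT1 (cid (bopP T).1).

Lemma bop_adj_funP T : adjoint_pair T (bop_adj_fun T).
Proof. by rewrite /bop_adj_fun; case: cid. Qed.

Fact bop_adj_subproof T : bop_adj_fun T \in @bounded_adjointable R H.
Proof.
apply/asboolP; split.
  by exists T; apply/adjoint_pair_sym/bop_adj_funP.
exists `|T|; apply: norm_bound_adjoint (bop_adj_funP T) _ _ => //.
exact: bop_bound.
Qed.

Definition bop_adj T : bop H := Bop (bop_adj_subproof T).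

Lemma ip_adjl T x y : ip (T x) y = ip x (bop_adj T y).
Proof. exact: bop_adj_funP. Qed.

Lemma ip_adjr T x y : ip x (T y) = ip (bop_adj T x) y.
Proof. by rewrite ipC ip_adjl -ipC. Qed.

Lemma bop_adj_uniq T (S : bop H) : adjoint_pair T S -> bop_adj T = S.
Proof.
move=> TS; apply: val_inj; apply: adjoint_pair_uniq TS.
exact: bop_adj_funP.
Qed.

Lemma bop_adjK T : bop_adj (bop_adj T) = T.
Proof. by apply: bop_adj_uniq => x y; rewrite -ip_adjr. Qed.

Lemma bop_norm_adj T : `|bop_adj T| = `|T|.
Proof.
have le S : `|bop_adj S| <= `|S|.
  apply: bop_norm_le => //.
  apply: norm_bound_adjoint (bop_adj_funP S) _ _ => //.
  exact: bop_bound.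
by apply/le_anti; rewrite le -[in leLHS](bop_adjK T) le.
Qed.

Lemma bop_adjD S T : bop_adj (S + T) = bop_adj S + bop_adj T.
Proof. by apply: bop_adj_uniq => x y; rewrite bopDE ipDl ipDr !ip_adjl. Qed.

Lemma bop_adjZ a T : bop_adj (a *: T) = a^* *: bop_adj T.
Proof.
by apply: bop_adj_uniq => x y; rewrite bopZE ipZl ipZr conjCK ip_adjl.
Qed.

Lemma bop_adjB S T : bop_adj (S - T) = bop_adj S - bop_adj T.
Proof. by rewrite -scaleN1r bop_adjD bop_adjZ rmorphN1 scaleN1r. Qed.

Fact bop_one_subproof : idfun \in @bounded_adjointable R H.
Proof.
by apply/asboolP; split; [exists idfun|exists 1 => x; rewrite mul1r].
Qed.

Definition bop_one : bop H := Bop bop_one_subproof.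

Fact bop_comp_subproof S T : S \o T \in @bounded_adjointable R H.
Proof.
apply/asboolP; split.
  by eexists; apply: adjoint_pair_comp; exact: bop_adj_funP.
exists (`|S| * `|T|) => x; rewrite /= (le_trans (bop_bound _ _))//.
by rewrite -mulrA ler_wpM2l// bop_bound.
Qed.

Definition bop_comp S T : bop H := Bop (bop_comp_subproof S T).

Lemma bop_compE S T x : bop_comp S T x = S (T x). Proof. by []. Qed.

Lemma bop_normM S T : `|bop_comp S T| <= `|S| * `|T|.
Proof.
apply: bop_norm_le => [|x]; first by rewrite mulr_ge0.
rewrite bop_compE (le_trans (bop_bound _ _))//.
by rewrite -mulrA ler_wpM2l// bop_bound.
Qed.

(** One inequality is submultiplicativity; for the other, Cauchy-Schwarz bounds [|T x|^2], which is
    the inner product of [x] with its image under [bop_comp (bop_adj T) T]. *)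
Lemma bop_cstar T : `|bop_comp (bop_adj T) T| = `|T| ^+ 2.
Proof.
apply/le_anti; rewrite (le_trans (bop_normM _ _)) ?bop_norm_adj ?expr2 //=.
rewrite -expr2 -[leRHS]sqrtCK ler_pXn2r ?nnegrE ?sqrtC_ge0 //.
apply: bop_norm_le => [|x]; first by rewrite sqrtC_ge0.
rewrite -(@ler_pXn2r _ 2) ?nnegrE ?mulr_ge0 ?sqrtC_ge0 // exprMn sqrtCK.
have Tx : `|T x| ^+ 2 = ip x (bop_comp (bop_adj T) T x).
  by rewrite -ip_norm ip_adjl.
rewrite -[leLHS]ger0_norm ?exprn_ge0 // Tx (le_trans (ip_CauchySchwarz _ _))//.
by rewrite mulrC expr2 mulrA ler_wpM2r// bop_bound.
Qed.

(** Adjunction is isometric, so the adjoints are Cauchy along [F] as well. The pointwise limits [L]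
    and [L'] of operators and adjoints form an adjoint pair, which makes [L] an element of
    [bop H]. *)
Lemma bop_complete (F : set_system (bop H)) :
  ProperFilter F -> cauchy F -> cvg F.
Proof.
move=> FF /cauchy_along_id cF.
have pt (x : H) (G : bop H -> bop H) : (forall S T, `|G S - G T| = `|S - T|) ->
    exists l : H, (fun T => G T x) @ F --> l.
  move=> isoG; apply: cauchy_along_cvg => e e0.
  have d0 : 0 < `|x| + 1 by rewrite ltr_wpDl.
  have [A FA Ae] := cF (e / (`|x| + 1)) (divr_gt0 e0 d0).
  exists A => // S T AS AT; rewrite -bopBE (le_trans (bop_bound _ _))//.
  rewrite isoG (le_trans (ler_wpM2r _ (Ae _ _ AS AT)))// -mulrA.
  rewrite ler_piMr ?(ltW e0) // ler_pdivrMl // mulr1 lerDl //.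
have id_iso S T : `|id S - id T| = `|S - T| by [].
have adj_iso S T : `|bop_adj S - bop_adj T| = `|S - T|.
  by rewrite -bop_adjB bop_norm_adj.
pose L x := projT1 (cid (pt x id id_iso)).
pose L' x := projT1 (cid (pt x bop_adj adj_iso)).
have LE e : 0 < e -> exists2 A, F A &
    forall T, A T -> forall x, `|T x - L x| <= e * `|x|.
  move=> e0; have [A FA Ae] := cF e e0; exists A => // T AT x.
  have lx : (fun T : bop H => T x) @ F --> L x by rewrite /L; case: cid.
  apply: (@cauchy_along_dist _ _ _ F _ _ (L x) A _ T lx FA) => [|S AS];
    first by rewrite mulr_ge0 ?(ltW e0).
  by rewrite -bopBE (le_trans (bop_bound _ _))// ler_wpM2r// Ae.
have L'E e : 0 < e -> exists2 A, F A &
    forall T, A T -> forall x, `|bop_adj T x - L' x| <= e * `|x|.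
  move=> e0; have [A FA Ae] := cF e e0; exists A => // T AT x.
  have lx : (fun T => bop_adj T x) @ F --> L' x by rewrite /L'; case: cid.
  apply: (@cauchy_along_dist _ _ _ F _ _ (L' x) A _ T lx FA) => [|S AS];
    first by rewrite mulr_ge0 ?(ltW e0).
  by rewrite -bopBE (le_trans (bop_bound _ _))// adj_iso ler_wpM2r// Ae.
have LL' : adjoint_pair L L'.
  move=> x y; apply/eqP; rewrite -subr_eq0 -normr_le0.
  apply/ler_addgt0Pr => e e0; rewrite add0r.
  (* Adding 1 keeps the denominator positive when [x] or [y] is 0; the factor 2 shares [e] between
     [L] and [L']. *)
  have d0 : 0 < (`|x| * `|y| + 1) * 2 by rewrite mulr_gt0 // ltr_wpDl ?mulr_ge0.
  have [A FA Ad] := LE _ (divr_gt0 e0 d0).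
  have [B FB Bd] := L'E _ (divr_gt0 e0 d0).
  have [T [AT BT]] := filter_ex (filterI FA FB).
  rewrite -(subrKA (ip (T x) y)) -ipBl [X in _ + (X - _)]ip_adjl -ipBr.
  rewrite (le_trans (ler_normD _ _))//.
  set d := e / _ in Ad Bd.
  have dd : d * `|x| * `|y| + d * `|x| * `|y| <= e.
    have dE : d * ((`|x| * `|y| + 1) * 2) = e by rewrite /d divfK // gt_eqF.
    have d_ge0 : 0 <= d := ltW (divr_gt0 e0 d0).
    clearbody d; rewrite -[leRHS]dE -!mulrA -mulrDr ler_wpM2l //.
    by rewrite [leRHS]mulr_natr mulr2n lerD // lerDl.
  apply: le_trans dd; apply: lerD.
    by rewrite (le_trans (ip_CauchySchwarz _ _))// ler_wpM2r// distrC Ad.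
  rewrite (le_trans (ip_CauchySchwarz _ _))// [d * _]mulrC -mulrA.
  by rewrite ler_wpM2l// Bd.
have LB : exists M, norm_bound L M.
  have [A FA A1] := LE 1 ltr01; have [T AT] := filter_ex FA.
  exists (1 + `|T|) => x; rewrite -(subKr (T x) (L x)).
  rewrite (le_trans (ler_normB _ _))// mulrDl addrC lerD ?bop_bound //.
  exact: A1.
have LP : L \in @bounded_adjointable R H.
  by apply/asboolP; split=> //; exists L'.
apply/cvg_ex; exists (Bop LP); apply/cvgrPdist_le => e e0.
have [A FA Ae] := LE e e0; apply: filterS FA => T AT.
apply: bop_norm_le => [|x]; first exact: ltW.
by rewrite bopBE distrC; exact: Ae.
Qed.

HB.instance Definition _ := Uniform_isComplete.Build (bop H) bop_complete.

Lemma bop_compA : associative bop_comp.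
Proof. by move=> S T U; apply: bop_ext. Qed.

Lemma bop_comp1x : left_id bop_one bop_comp.
Proof. by move=> T; apply: bop_ext. Qed.

Lemma bop_compx1 : right_id bop_one bop_comp.
Proof. by move=> T; apply: bop_ext. Qed.

Lemma bop_compDl : left_distributive bop_comp +%R.
Proof. by move=> S T U; apply: bop_ext. Qed.

Lemma bop_compDr : right_distributive bop_comp +%R.
Proof. by move=> S T U; apply: bop_ext => x; rewrite /= bopD. Qed.

Lemma bop_scaleAl a S T : a *: bop_comp S T = bop_comp (a *: S) T.
Proof. exact: bop_ext. Qed.

Lemma bop_scaleAr a S T : a *: bop_comp S T = bop_comp S (a *: T).
Proof. by apply: bop_ext => x; rewrite /= bopZ. Qed.

Lemma bop_adjM S T : bop_adj (bop_comp S T) = bop_comp (bop_adj T) (bop_adj S).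
Proof. by apply: bop_adj_uniq => x y; rewrite !bop_compE !ip_adjl. Qed.

HB.instance Definition _ := isCStarAlgebra.Build R (bop H)
  bop_compA bop_comp1x bop_compx1 bop_compDl bop_compDr bop_scaleAl bop_scaleAr
  bop_normM bop_adjK bop_adjD bop_adjZ bop_adjM bop_cstar.

End BoundedOperatorNorm.

(** * The Hilbert space of square-summable families *)

Lemma cvg_conjC (C : numClosedFieldType) T (F : set_system T) (FF : Filter F)
    (u : T -> C) (l : C) :
  u @ F --> l -> (fun x => (u x)^*) @ F --> l^*.
Proof.
move=> /cvgrPdist_le ul; apply/cvgrPdist_le => e e0.
by apply: filterS (ul _ e0) => x; rewrite -rmorphB /= norm_conjC.
Qed.

(** The order of [K] may be partial. Eventually [b - u x] is its own norm, hence so is its limit,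
    which is therefore non-negative. *)
Lemma cvg_le_cst (K : numFieldType) T (F : set_system T) (FF : ProperFilter F)
    (u : T -> K) (l b : K) :
  u @ F --> l -> (\forall x \near F, u x <= b) -> l <= b.
Proof.
move=> ul ub; have bul : (fun x => b - u x) @ F --> b - l.
  by apply: cvgB => //; exact: cvg_cst.
have nbul : (fun x => b - u x) @ F --> `|b - l|.
  apply: cvg_trans (cvg_norm bul); apply: near_eq_cvg.
  by apply: filterS ub => x uxb; rewrite ger0_norm ?subr_ge0.
by rewrite -subr_ge0 ger0_def; apply/eqP; exact: norm_cvg_unique nbul bul.
Qed.

Lemma cvg_ge_cst (K : numFieldType) T (F : set_system T) (FF : ProperFilter F)
    (u : T -> K) (l b : K) :
  u @ F --> l -> (\forall x \near F, b <= u x) -> b <= l.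
Proof.
move=> ul ub; rewrite -lerN2.
apply: (@cvg_le_cst _ _ F _ (fun x => - u x)); first exact: cvgN.
by apply: filterS ub => x; rewrite lerN2.
Qed.

Section ComplexLimits.
Variable R : realType.

Lemma cvg_real_complex T (F : set_system T) (FF : Filter F) (u : T -> R)
    (l : R) :
  u @ F --> l -> (fun x => (u x)%:C) @ F --> (l%:C : R[i]^o).
Proof.
move=> /cvgrPdist_le ul; apply/(@cvgrPdist_le R[i] R[i]^o) => e e0.
have eR : (complex.Re e)%:C = e by rewrite RRe_real ?gtr0_real.
have e0' : 0 < complex.Re e by rewrite -ltcR eR.
apply: filterS (ul _ e0') => x; rewrite -lecR eR; apply: le_trans.
by rewrite -rmorphB /= normc_def /= expr0n addr0 sqrtr_sqr.
Qed.

Lemma normc_ge_Im (z : R[i]) : `|complex.Im z|%:C <= `|z|.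
Proof.
have := normc_ge_Re (z * 'i%C); rewrite ReiNIm normrN.
by rewrite normrM [`|'i%C|]normc_def /= expr0n add0r expr1n sqrtr1 mulr1.
Qed.

Lemma complex_cauchy_cvg T (F : set_system T) (FF : ProperFilter F)
    (f : T -> R[i]^o) :
  cauchy_along F f -> exists l : R[i]^o, f @ F --> l.
Proof.
move=> cf; have part (p : R[i] -> R) : (forall z w, p (z - w) = p z - p w) ->
    (forall z, `|p z|%:C <= `|z|) -> exists a : R^o, (p \o f) @ F --> a.
  move=> pB pn; apply: cauchy_along_cvg => e e0.
  have [|A FA Ae] := cf e%:C; first by rewrite ltcR.
  exists A => // x y Ax Ay; rewrite -lecR -pB.
  exact: le_trans (pn _) (Ae _ _ Ax Ay).
have [||a fa] := part (@complex.Re R).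
- by move=> [? ?] [? ?].
- exact: normc_ge_Re.
have [||b fb] := part (@complex.Im R).
- by move=> [? ?] [? ?].
- exact: normc_ge_Im.
exists (a%:C + 'i%C * b%:C).
have -> : f = (fun x => (complex.Re (f x))%:C + 'i%C * (complex.Im (f x))%:C).
  by apply/funext => x; rewrite -complexE.
apply: cvgD; first exact: cvg_real_complex fa.
by apply: cvgM; [exact: cvg_cst|exact: cvg_real_complex fb].
Qed.

End ComplexLimits.

Section PartialSums.
Variables (K : numClosedFieldType) (I : finType).
Implicit Types f g h : I * nat -> K^o.

(** Cutting by the second coordinate keeps the sums finite and suits the blocks on which the shift
    operators act. *)
Definition psum f g (N : nat) : K :=
  \sum_(n < N) \sum_i f (i, n : nat) * (g (i, n : nat))^*.

Definition square_summable : pred (I * nat -> K^o) :=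
  fun f => `[< exists M, forall N, psum f f N <= M >].

Lemma psumDl f g h N : psum (f + g) h N = psum f h N + psum g h N.
Proof.
rewrite -big_split; apply: eq_bigr => n _; rewrite -big_split.
by apply: eq_bigr => i _; rewrite /= -mulrDl.
Qed.

Lemma psumZl a f g N : psum (a *: f) g N = a * psum f g N.
Proof.
rewrite mulr_sumr; apply: eq_bigr => n _; rewrite mulr_sumr.
by apply: eq_bigr => i _; rewrite mulrA.
Qed.

Lemma psumC f g N : psum g f N = (psum f g N)^*.
Proof.
rewrite rmorph_sum; apply: eq_bigr => n _ /=; rewrite rmorph_sum.
by apply: eq_bigr => i _ /=; rewrite rmorphM /= conjCK mulrC.
Qed.

Lemma psum_term_ge0 f n : 0 <= \sum_i f (i, n) * (f (i, n))^*.
Proof. by apply: sumr_ge0 => i _; rewrite -normCK exprn_ge0. Qed.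

Lemma psum_ge0 f N : 0 <= psum f f N.
Proof. by apply: sumr_ge0 => n _; exact: psum_term_ge0. Qed.

Lemma psum_nd f M N : (M <= N)%N -> psum f f M <= psum f f N.
Proof.
elim: N => [|N IH]; first by rewrite leqn0 => /eqP ->.
rewrite leq_eqVlt ltnS => /predU1P[-> //|/IH MN].
by rewrite (le_trans MN)// [leRHS]big_ord_recr lerDl psum_term_ge0.
Qed.

Lemma psumDr f g h N : psum f (g + h) N = psum f g N + psum f h N.
Proof.
exact: form_Dr (fun x y z => psumDl x y z N) (fun x y => psumC x y N) _ _ _.
Qed.

Lemma psumZr a f g N : psum f (a *: g) N = a^* * psum f g N.
Proof.
exact: form_Zr (fun a x y => psumZl a x y N) (fun x y => psumC x y N) _ _ _.
Qed.

Lemma psum_parallelogram f g N :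
  psum (f + g) (f + g) N + psum (f - g) (f - g) N =
  2 * psum f f N + 2 * psum g g N.
Proof.
rewrite -(scaleN1r g) !psumDl !psumDr !psumZl !psumZr rmorphN1.
by ring.
Qed.

(** Reduces the convergence of mixed sums to that of four diagonal ones, which are monotone. *)
Lemma psum_polarization f g N :
  psum f g N = 4^-1 * ((psum (f + g) (f + g) N - psum (f - g) (f - g) N) +
    'i * (psum (f + 'i *: g) (f + 'i *: g) N -
          psum (f - 'i *: g) (f - 'i *: g) N)).
Proof.
rewrite -(scaleN1r g) -(scaleN1r ('i *: g)) !psumDl !psumDr !psumZl !psumZr.
rewrite rmorphN1 conjCi.
set p := psum f f N; set q := psum f g N; set r := psum g f N.
set s := psum g g N.
(* The unwanted terms carry the factor 1 + i^2, isolated here because [ring] treats i as a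
   variable. *)
transitivity (4^-1 * (4 * q + (1 + 'i * 'i) * (2 * (r - q)))); last by ring.
by rewrite -expr2 sqrCi subrr mul0r addr0 mulKf ?pnatr_eq0.
Qed.

Lemma psum_cvg_polarization f g a b c d :
  psum (f + g) (f + g) @ \oo --> a -> psum (f - g) (f - g) @ \oo --> b ->
  psum (f + 'i *: g) (f + 'i *: g) @ \oo --> c ->
  psum (f - 'i *: g) (f - 'i *: g) @ \oo --> d ->
  psum f g @ \oo --> 4^-1 * ((a - b) + 'i * (c - d)).
Proof.
move=> fa fb fc fd; have -> : psum f g = _ := funext (psum_polarization f g).
apply: cvgMr; apply: cvgD; first exact: cvgB.
by apply: cvgMr; exact: cvgB.
Qed.

Lemma psum_cvgDl f g h a b : psum f h @ \oo --> a -> psum g h @ \oo --> b ->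
  psum (f + g) h @ \oo --> a + b.
Proof.
move=> fa gb; have -> : psum (f + g) h = psum f h \+ psum g h.
  by apply/funext => N; rewrite psumDl.
exact: cvgD.
Qed.

Lemma psum_cvgZl a f g l :
  psum f g @ \oo --> l -> psum (a *: f) g @ \oo --> a * l.
Proof.
move=> fl; have -> : psum (a *: f) g = fun N => a * psum f g N.
  by apply/funext => N; rewrite psumZl.
exact: cvgMr.
Qed.

Lemma psum_cvgC f g l : psum f g @ \oo --> l -> psum g f @ \oo --> l^*.
Proof.
move=> fl; have -> : psum g f = fun N => (psum f g N)^*.
  by apply/funext => N; rewrite psumC.
exact: cvg_conjC.
Qed.

Lemma psum_cvg_dist T (F : set_system T) (FF : Filter F) f
    (h : T -> I * nat -> K) (l : I * nat -> K) N :
  (forall x, (fun v => h v x) @ F --> l x) ->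
  (fun v => psum (f - (h v : _ -> K^o)) (f - (h v : _ -> K^o)) N) @ F -->
    psum (f - (l : _ -> K^o)) (f - (l : _ -> K^o)) N.
Proof.
move=> hl; apply: cvg_big => [|n _]; first exact: add_continuous.
apply: cvg_big => [|i _]; first exact: add_continuous.
have fl : (fun v => f (i, n : nat) - h v (i, n : nat)) @ F -->
    (f (i, n : nat) - l (i, n : nat) : K).
  by apply: cvgB; [exact: cvg_cst|exact: hl].
by apply: cvgM => //; exact: cvg_conjC.
Qed.

Lemma square_summable_submod : submod_closed square_summable.
Proof.
split.
  apply/asboolP; exists 0 => N; rewrite -(scale0r (0 : I * nat -> K^o)) psumZl.
  by rewrite mul0r.
move=> a f g /asboolP[M fM] /asboolP[L gL]; apply/asboolP.
exists (2 * (a * a^* * M) + 2 * L) => N.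
apply: (@le_trans _ _ (2 * psum (a *: f) (a *: f) N + 2 * psum g g N)).
  by rewrite -psum_parallelogram lerDl psum_ge0.
rewrite lerD // ler_pM2l // psumZl psumZr mulrA ler_wpM2l //.
by rewrite -normCK exprn_ge0.
Qed.

HB.instance Definition _ :=
  GRing.isSubmodClosed.Build _ _ square_summable square_summable_submod.

End PartialSums.

Section SquareSummable.
Variables (R : realType) (I : finType).

Local Notation K := (R[i] : numClosedFieldType).

Record l2 := L2 {
  l2_fun :> I * nat -> R[i]^o;
  l2_prop : l2_fun \in @square_summable R[i] I }.

HB.instance Definition _ := [isSub for l2_fun].
HB.instance Definition _ := [Choice of l2 by <:].
HB.instance Definition _ := [SubChoice_isSubLmodule of l2 by <:].

Implicit Types u v w : l2.

Lemma l2P u : exists M, forall N, psum u u N <= M.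
Proof. exact/asboolP/l2_prop. Qed.

Lemma l2_ext u v : (forall x, u x = v x) -> u = v.
Proof. by move=> uv; apply: val_inj; apply/funext. Qed.

Lemma l2_funD u v : l2_fun (u + v) = l2_fun u + l2_fun v.
Proof. exact: (raddfD (val : l2 -> _)). Qed.

Lemma l2_funB u v : l2_fun (u - v) = l2_fun u - l2_fun v.
Proof. exact: (raddfB (val : l2 -> _)). Qed.

Lemma l2_funZ a u : l2_fun (a *: u) = a *: l2_fun u.
Proof. by []. Qed.

Lemma psum_diag_cvg u : exists l : K, psum u u @ \oo --> l.
Proof.
have [M uM] := l2P u.
have real (z : R[i]) : 0 <= z -> (complex.Re z)%:C = z.
  by move=> z0; rewrite RRe_real ?ger0_real.
have M0 : 0 <= M := le_trans (psum_ge0 u 0) (uM 0).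
pose r N := complex.Re (psum u u N).
have rE : psum u u = fun N => (r N)%:C.
  by apply/funext => N; rewrite real ?psum_ge0.
have : cvgn r.
  apply: nondecreasing_is_cvgn => [m n mn|].
    by rewrite -lecR !real ?psum_ge0 ?psum_nd.
  by exists (complex.Re M) => _ [N _ <-]; rewrite -lecR !real ?psum_ge0.
by move=> rl; exists (limn r)%:C; rewrite rE; exact: cvg_real_complex rl.
Qed.

Lemma psum_cvg u v : exists l : K, psum u v @ \oo --> l.
Proof.
have [a ca] := psum_diag_cvg (u + v).
have [b cb] := psum_diag_cvg (u - v).
have [c cc] := psum_diag_cvg (u + 'i *: v).
have [d cd] := psum_diag_cvg (u - 'i *: v).
exists (4^-1 * ((a - b) + 'i * (c - d))).
apply: psum_cvg_polarization.
- rewrite -l2_funD; exact: ca.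
- rewrite -l2_funB; exact: cb.
- rewrite -l2_funZ -l2_funD; exact: cc.
- rewrite -l2_funZ -l2_funB; exact: cd.
Qed.

Definition l2_ip u v : R[i] := projT1 (cid (psum_cvg u v)).

Lemma l2_ipP u v : psum u v @ \oo --> (l2_ip u v : K).
Proof. by rewrite /l2_ip; case: cid. Qed.

Lemma l2_ip_lim u v (l : K) : psum u v @ \oo --> l -> l2_ip u v = l.
Proof. by move=> uvl; exact: norm_cvg_unique (@l2_ipP u v) uvl. Qed.

Lemma l2_ipDl u v w : l2_ip (u + v) w = l2_ip u w + l2_ip v w.
Proof.
by apply: l2_ip_lim; rewrite l2_funD; apply: psum_cvgDl; exact: l2_ipP.
Qed.

Lemma l2_ipZl a u v : l2_ip (a *: u) v = a * l2_ip u v.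
Proof.
by apply: l2_ip_lim; rewrite l2_funZ; apply: psum_cvgZl; exact: l2_ipP.
Qed.

Lemma l2_ipC u v : l2_ip v u = (l2_ip u v)^*.
Proof. by apply: l2_ip_lim; apply: psum_cvgC; exact: l2_ipP. Qed.

Lemma psum_le_ip u N : psum u u N <= l2_ip u u.
Proof.
apply: (cvg_ge_cst _ (@l2_ipP u u)).
by exists N => // M NM; exact: psum_nd.
Qed.

Lemma l2_ip_ge0 u : 0 <= l2_ip u u.
Proof. exact: le_trans (psum_ge0 u 0) (psum_le_ip u 0). Qed.

Lemma l2_coord_sq_le u i n : `|u (i, n)| ^+ 2 <= l2_ip u u.
Proof.
apply: le_trans (psum_le_ip u n.+1); rewrite normCK /psum big_ord_recr /=.
rewrite (bigD1 i) //= addrCA lerDl addr_ge0 ?psum_ge0 // sumr_ge0 // => j _.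
by rewrite -normCK exprn_ge0.
Qed.

Lemma l2_ip_eq0 u : l2_ip u u = 0 -> u = 0.
Proof.
move=> u0; apply: l2_ext => -[i n]; apply/eqP; rewrite -normr_eq0 -sqrf_eq0.
by rewrite eq_le exprn_ge0 // andbT -u0 l2_coord_sq_le.
Qed.

HB.instance Definition _ := Lmodule_isNormed.Build R[i] l2
  (form_normD l2_ipDl l2_ipZl l2_ipC l2_ip_ge0 l2_ip_eq0)
  (form_normZ l2_ipZl l2_ipC l2_ip_ge0) (form_norm_eq0 l2_ip_eq0).

Lemma l2_ip_norm u : l2_ip u u = `|u| ^+ 2.
Proof. exact/esym/form_norm_sq. Qed.

Lemma l2_coord_le u x : `|u x| <= `|u|.
Proof.
case: x => i n; rewrite -(@ler_pXn2r _ 2) ?nnegrE // -l2_ip_norm.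
exact: l2_coord_sq_le.
Qed.

(** The limit is taken coordinatewise. The Cauchy estimate passes to the limit in each truncated
    sum, with a bound uniform in [N], and only then does [N] grow. *)
Lemma l2_complete (F : set_system l2) : ProperFilter F -> cauchy F -> cvg F.
Proof.
move=> FF /cauchy_along_id cF.
have pt (x : I * nat) : exists l : R[i]^o, (fun u : l2 => u x) @ F --> l.
  apply: complex_cauchy_cvg => e /cF[A FA Ae]; exists A => // u v Au Av.
  exact: le_trans (l2_coord_le (u - v) x) (Ae _ _ Au Av).
pose L x := projT1 (cid (pt x)).
have LP x : (fun u : l2 => u x) @ F --> L x by rewrite /L; case: cid.
have close e : 0 < e -> exists2 A, F A &
    forall u, A u -> forall N, psum (l2_fun u - L) (l2_fun u - L) N <= e ^+ 2.
  move=> e0; have [A FA Ae] := cF e e0; exists A => // u Au N.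
  apply: (@cvg_le_cst _ _ F _ (fun v : l2 => psum (u - v) (u - v) N)).
    exact: psum_cvg_dist LP.
  apply: filterS FA => v Av; apply: le_trans (psum_le_ip _ _) _.
  by rewrite l2_ip_norm ler_pXn2r ?nnegrE ?(ltW e0) // Ae.
have Ll2 : L \in @square_summable R[i] I.
  have [A FA A1] := close 1 ltr01; have [u Au] := filter_ex FA.
  have uL : l2_fun u - L \in @square_summable R[i] I.
    by apply/asboolP; exists (1 ^+ 2); exact: A1.
  by rewrite -(subKr (l2_fun u) L) rpredB // l2_prop.
apply/cvg_ex; exists (L2 Ll2); apply/cvgrPdist_le => e e0.
have [A FA Ae] := close e e0; apply: filterS FA => u Au.
rewrite distrC -(@ler_pXn2r _ 2) ?nnegrE ?(ltW e0) // -l2_ip_norm.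
apply: (cvg_le_cst _ (@l2_ipP _ _)); apply: nearW => N; exact: Ae.
Qed.

HB.instance Definition _ := Uniform_isComplete.Build l2 l2_complete.

HB.instance Definition _ :=
  isHilbert.Build R l2 l2_ipDl l2_ipZl l2_ipC l2_ip_norm.

End SquareSummable.

(** * The shift representation *)

Lemma sum_blocks (M : nmodType) (G : nat -> M) N d :
  \sum_(m < N * d) G m = \sum_(n < N) \sum_(j < d) G (n * d + j)%N.
Proof.
elim: N => [|N IH]; first by rewrite mul0n !big_ord0.
by rewrite mulSnr big_split_ord big_ord_recr -IH.
Qed.

Lemma bop_sumE (R : realType) (H : hilbertType R) (J : Type) (r : seq J)
    (P : pred J) (F : J -> bop H) (x : H) :
  (\sum_(j <- r | P j) F j) x = \sum_(j <- r | P j) F j x.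
Proof. exact: (big_morph (fun T : bop H => T x)). Qed.

Lemma l2_sumE (R : realType) (I : finType) (J : Type) (r : seq J)
    (P : pred J) (F : J -> l2 R I) x :
  (\sum_(j <- r | P j) F j) x = \sum_(j <- r | P j) F j x.
Proof. exact: (big_morph (fun u : l2 R I => u x)). Qed.

Section ShiftOperators.
Variables (R : realType) (V E : finType) (s t : E -> V).
Hypothesis h_out : forall v : V, exists e : E, s e = v.
Local Notation K := (R[i] : numClosedFieldType).
Variable e : E.
Implicit Types (f g : E * nat -> K^o) (u w : l2 R E).

Definition followers : seq E := enum [pred f | s f == t e].
Local Notation d := (size followers).

Lemma followers_gt0 : (0 < d)%N.
Proof.
have [f sf] := h_out (t e); rewrite -has_predT; apply/hasP; exists f => //.
by rewrite mem_enum inE sf.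
Qed.

(* [m] encodes the pair of [m %/ d] and the [(m %% d)]-th follower of [e], so
   that [(e, m)] ranges over the same set as the [(f, n)] with [s f = t e]. *)
Definition shift_fun f : E * nat -> K^o := fun x =>
  if x.1 == e then f (nth e followers (x.2 %% d), (x.2 %/ d)%N) else 0.

Definition coshift_fun f : E * nat -> K^o := fun x =>
  if s x.1 == t e then f (e, (x.2 * d + index x.1 followers)%N) else 0.

Lemma shiftK f x :
  coshift_fun (shift_fun f) x = if s x.1 == t e then f x else 0.
Proof.
rewrite /coshift_fun /shift_fun; case: x => a n /=; case: eqP => // sa.
have a_fol : a \in followers by rewrite mem_enum inE sa.
rewrite eqxx modnMDl modn_small ?index_mem // divnMDl ?followers_gt0 //.
by rewrite nth_index // divn_small ?index_mem // addn0.
Qed.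

Lemma coshiftK f x : shift_fun (coshift_fun f) x = if x.1 == e then f x else 0.
Proof.
rewrite /coshift_fun /shift_fun; case: x => a n /=; case: eqP => // ->.
have md : (n %% d < d)%N by rewrite ltn_pmod ?followers_gt0.
have := mem_nth e md; rewrite mem_enum inE => ->.
by rewrite index_uniq ?enum_uniq // -divn_eq.
Qed.

(** The codes below [N * d] are exactly those of the pairs with first component below [N], so the
    adjunction holds already for truncated sums. *)
Lemma psum_shift f g N :
  psum (shift_fun f) g (N * d) = psum f (coshift_fun g) N.
Proof.
rewrite /psum (sum_blocks (fun m => \sum_i shift_fun f (i, m) * (g (i, m))^*)).
apply: eq_bigr => n _; rewrite exchange_big /=.
rewrite [LHS](bigD1 e) //= [X in _ + X]big1 ?addr0; last first.
  by move=> a /negPf ae; apply: big1 => j _; rewrite /shift_fun /= ae mul0r.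
rewrite (bigID [pred a | s a == t e]) /= [X in _ = _ + X]big1 ?addr0;
  last first.
  by move=> a /negPf sa; rewrite /coshift_fun /= sa conjC0 mulr0.
transitivity (\sum_(a <- followers) f (a, n : nat) *
    (coshift_fun g (a, n : nat))^*); last by rewrite big_enum.
rewrite [RHS](big_nth e) big_mkord; apply: eq_bigr => j _.
rewrite /shift_fun /coshift_fun /= eqxx.
have /[!(mem_enum, inE)] -> := mem_nth e (ltn_ord j).
rewrite index_uniq ?enum_uniq // modnMDl modn_small //.
by rewrite divnMDl ?followers_gt0 // divn_small // addn0.
Qed.

Lemma psum_restrict f (P : pred (E * nat)) g N :
  (forall x, g x = if P x then f x else 0) ->
  [/\ psum g f N = psum g g N, psum f g N = psum g g N &
      psum g g N <= psum f f N].
Proof.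
move=> gP; split.
- apply: eq_bigr => n _; apply: eq_bigr => i _; rewrite !gP.
  by case: ifP => // _; rewrite !mul0r.
- apply: eq_bigr => n _; apply: eq_bigr => i _; rewrite !gP.
  by case: ifP => // _; rewrite conjC0 !mulr0.
- apply: ler_sum => n _; apply: ler_sum => i _; rewrite gP.
  by case: ifP => // _; rewrite mul0r -normCK exprn_ge0.
Qed.

Lemma psum_shift_le f N : psum (shift_fun f) (shift_fun f) N <= psum f f N.
Proof.
apply: (@le_trans _ _ (psum (shift_fun f) (shift_fun f) (N * d))).
  by rewrite psum_nd // leq_pmulr // followers_gt0.
rewrite psum_shift.
by have [_ -> ->] := psum_restrict N (shiftK f).
Qed.

Lemma psum_coshift_le f N :
  psum (coshift_fun f) (coshift_fun f) N <= psum f f (N * d).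
Proof.
rewrite -psum_shift.
by have [-> _ ->] := psum_restrict (N * d) (coshiftK f).
Qed.

Fact l2_shift_subproof u : shift_fun u \in @square_summable R[i] E.
Proof.
apply/asboolP; exists (l2_ip u u) => N.
exact: le_trans (psum_shift_le _ _) (psum_le_ip _ _).
Qed.

Fact l2_coshift_subproof u : coshift_fun u \in @square_summable R[i] E.
Proof.
apply/asboolP; exists (l2_ip u u) => N.
exact: le_trans (psum_coshift_le _ _) (psum_le_ip _ _).
Qed.

Definition l2_shift u : l2 R E := L2 (l2_shift_subproof u).
Definition l2_coshift u : l2 R E := L2 (l2_coshift_subproof u).

Lemma l2_shift_norm u : `|l2_shift u| <= `|u|.
Proof.
rewrite -(@ler_pXn2r _ 2) ?nnegrE // -l2_ip_norm.
apply: cvg_le_cst (@l2_ipP _ _ _ _) _; apply: nearW => N.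
by rewrite -l2_ip_norm (le_trans (psum_shift_le _ _)) // psum_le_ip.
Qed.

Lemma l2_shift_adjoint : adjoint_pair l2_shift l2_coshift.
Proof.
move=> u w; apply/esym/l2_ip_lim.
(* The truncated sums of one inner product are those of the other along the subsequence [N * d]. *)
have -> : psum u (coshift_fun w) = psum (shift_fun u) w \o (muln^~ d).
  by apply/funext => N; rewrite /= psum_shift.
apply: (@cvg_comp _ _ _ (muln^~ d) (psum (shift_fun u) w) _ \oo).
  move=> A [N _ NA]; exists N => // n /= Nn; apply: NA => /=.
  by rewrite (leq_trans Nn) // leq_pmulr // followers_gt0.
exact: (@l2_ipP _ _ (l2_shift u) w).
Qed.

Fact shift_subproof : l2_shift \in @bounded_adjointable R (l2 R E).
Proof.
apply/asboolP; split; first by exists l2_coshift; exact: l2_shift_adjoint.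
by exists 1 => u; rewrite mul1r l2_shift_norm.
Qed.

Definition shift_op : bop (l2 R E) := Bop shift_subproof.

Lemma shift_opE u x :
  shift_op u x =
  if x.1 == e then u (nth e followers (x.2 %% d), (x.2 %/ d)%N) else 0.
Proof. by []. Qed.

Lemma shift_op_adjE u x :
  bop_adj shift_op u x =
  if s x.1 == t e then u (e, (x.2 * d + index x.1 followers)%N) else 0.
Proof.
have -> // : bop_adj shift_op u = l2_coshift u.
apply: ip_injr => w; rewrite -ip_adjl; exact: l2_shift_adjoint.
Qed.

Lemma shift_op_adjK u x :
  shift_op (bop_adj shift_op u) x = if x.1 == e then u x else 0.
Proof. by rewrite -[RHS](coshiftK u) shift_opE shift_op_adjE. Qed.

Lemma shift_opK u x :
  bop_adj shift_op (shift_op u) x = if s x.1 == t e then u x else 0.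
Proof. by rewrite -[RHS](shiftK u) shift_op_adjE. Qed.

End ShiftOperators.

Section ShiftFamily.
Variables (R : realType) (V E : finType) (s t : E -> V).
Hypothesis h_out : forall v : V, exists e : E, s e = v.

Lemma bop_cmulE (S T : bop (l2 R E)) u : cmul S T u = S (T u).
Proof. by []. Qed.

Lemma bop_starE (S : bop (l2 R E)) : star S = bop_adj S.
Proof. by []. Qed.

Local Notation S := (@shift_op R V E s t h_out).

Lemma shift_op_projE f u x :
  cmul (S f) (star (S f)) u x = if x.1 == f then u x else 0.
Proof. exact: shift_op_adjK. Qed.

(** In coordinates, [S e ** star (S e)] keeps the indices whose edge is [e], and [star (S e) ** S e]
    those whose edge starts at [t e]; each sum in the relations has at most one non-zero term. *)
Lemma shift_op_CK : cuntz_krieger_family (edge_adj s t) S.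
Proof.
split=> [e||e]; apply: bop_ext => u; apply: l2_ext => x.
- by rewrite bop_cmulE shift_op_projE shift_opE; case: (x.1 == e).
- rewrite bop_sumE l2_sumE (bigD1 x.1) // big1 => [|f /andP[_ /negPf fx]].
    by rewrite [LHS]addr0 shift_op_projE eqxx.
  by rewrite shift_op_projE eq_sym fx.
- rewrite bop_cmulE bop_starE shift_opK.
  rewrite bop_sumE l2_sumE (bigD1 x.1) // big1 => [|f /andP[_ /negPf fx]].
    rewrite [RHS]addr0 /edge_adj eq_sym; case: (t e == s x.1) => //.
    by rewrite mulr1n shift_op_projE eqxx.
  rewrite /edge_adj; case: (t e == s f) => //.
  by rewrite mulr1n shift_op_projE eq_sym fx.
Qed.

Definition delta_fun (x : E * nat) : E * nat -> R[i]^o :=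
  fun y => if y == x then 1 else 0.

Fact delta_subproof x : delta_fun x \in @square_summable R[i] E.
Proof.
apply/asboolP; exists 1 => N; rewrite /psum pair_big /=.
case: (pselect (x.2 < N)%N) => xN.
  rewrite (bigD1 (Ordinal xN, x.1)) //= big1 => [|[n a] /=].
    by rewrite /delta_fun -surjective_pairing eqxx conjC1 mulr1 addr0.
  rewrite /delta_fun => nx; case: eqP => [ax|]; last by rewrite mul0r.
  have [aE nE] : a = x.1 /\ n = x.2 :> nat by rewrite -ax.
  by case/eqP: nx; rewrite aE; congr (_, _); exact: val_inj.
rewrite big1 ?ler01 // => -[n a] _ /=.
rewrite /delta_fun; case: eqP => [ax|]; last by rewrite mul0r.
by case: xN; rewrite -ax /= ltn_ord.
Qed.

Definition delta x : l2 R E := L2 (delta_subproof x).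

(** The projection fixes the unit vector at [(e, 0)] for an edge [e] leaving [v]. *)
Lemma shift_vertex_proj_neq0 v :
  vertex_proj s S v != 0.
Proof.
have [e se] := h_out v; apply/eqP => P0; pose x := (e, 0%N).
have := congr1 (fun T : bop (l2 R E) => T (delta x) x) P0.
rewrite /vertex_proj bop_sumE l2_sumE (bigD1 e) ?se // big1.
  rewrite [LHS]addr0 shift_op_projE eqxx [LHS]/= /delta_fun eqxx => /eqP.
  by rewrite oner_eq0.
by move=> f /andP[_ /negPf fe]; rewrite shift_op_projE /= eq_sym fe.
Qed.

End ShiftFamily.

(** * Transfer to the universal algebras and conclusion *)

Section Morphisms.
Variables (R : realType) (A B : cstarAlgType R) (phi : A -> B).
Hypothesis phiP : star_morphism phi.

Lemma star_morphismD x y : phi (x + y) = phi x + phi y.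
Proof. by case: phiP => lin _ _ _; rewrite -[x]scale1r lin !scale1r. Qed.

Lemma star_morphism0 : phi 0 = 0.
Proof. by apply: (addrI (phi 0)); rewrite -star_morphismD !addr0. Qed.

Lemma star_morphism_vertex_proj (V E : finType) (s : E -> V) (S : E -> A)
    (T : E -> B) : (forall e, phi (S e) = T e) ->
  forall v, phi (vertex_proj s S v) = vertex_proj s T v.
Proof.
case: phiP => _ _ phiM phi_star ST v.
rewrite /vertex_proj (big_morph phi star_morphismD star_morphism0).
by apply: eq_bigr => f _; rewrite phiM phi_star ST.
Qed.

End Morphisms.

Lemma CK_algebra_vertex_proj_neq0 (R : realType) (V E : finType) (s t : E -> V)
    (h_out : forall v : V, exists e : E, s e = v)
    (A : cstarAlgType R) (S : E -> A) :
  is_cuntz_krieger_algebra (edge_adj s t) S ->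
  forall v, vertex_proj s S v != 0.
Proof.
case=> _ _ univ v; have [phi [phiP phiS]] := univ _ _ (shift_op_CK R t h_out).
apply: contra_neq (shift_vertex_proj_neq0 R t h_out v) => Sv0.
by rewrite -(star_morphism_vertex_proj phiP s phiS) Sv0 star_morphism0.
Qed.

(** On the graph with a single vertex and the elements of [E] as loops, [edge_adj] is constantly 1
    and the shift operators form a Cuntz family. A unital morphism from [A] to them excludes 1 = 0
    in [A]. *)
Lemma cuntz_algebra_neq0 (R : realType) (E : finType) (E_gt0 : (0 < #|E|)%N)
    (A : cstarAlgType R) (T : E -> A) :
  is_cuntz_algebra T -> (cstar1 : A) != 0.
Proof.
case=> _ _ univ; pose s (e : E) := tt.
have h_out (v : unit) : exists e : E, s e = v.
  by have /card_gt0P[e _] := E_gt0; exists e; case: v.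
have [_ S_sum S_src] := shift_op_CK R s h_out.
have [|phi [phiP _]] := univ _ (@shift_op R _ E s s h_out).
  by split=> // e; rewrite S_src -S_sum; apply: eq_bigr => f _; rewrite mulr1n.
have [_ phi1 _ _] := phiP.
apply: contra_neq (shift_vertex_proj_neq0 R s h_out tt) => one0.
by rewrite -[LHS]cmul1x -phi1 one0 (star_morphism0 phiP) cmul0x.
Qed.

(** For [n > 0], the condition [eval_word S X != 0] follows from the value being the non-zero
    projection at [u]. For [n = 0], the convention 1 counts the empty walk. *)
Lemma c_coefE (R : realType) (V E : finType) (s t : E -> V)
    (OA OE : cstarAlgType R) (S : E -> OA) (T : E -> OE)
    (S_CK : cuntz_krieger_family (edge_adj s t) S)
    (T_cuntz : cuntz_family T) (E_ge2 : (2 <= #|E|)%N)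
    (OE_neq0 : (cstar1 : OE) != 0) (Pv_neq0 : forall v, vertex_proj s S v != 0)
    n u :
  c_coef s S T n u = walk_count s t (2 * n) u [::].
Proof.
case: n => [|n]; first by rewrite muln0.
rewrite -card_closed_walk /c_coef /=; apply: eq_card => X; rewrite !inE.
rewrite (eval_word_balanced T_cuntz) //.
have : size X = (2 * n.+1)%N by rewrite size_tuple.
case: (tval X) => [//|x Y] _.
have [bX|nbX] := boolP (balanced [::] (x :: Y)); last first.
  by rewrite andbF; apply/esym/negP => /closed_walk_balanced; apply/negP.
rewrite andbT (closed_walk_eval_word S_CK) //.
apply: andb_idl => walk.
by move: walk; rewrite -(closed_walk_eval_word S_CK) // => /eqP ->.
Qed.

Theorem proposition6p1 (R : realType) (V E : finType) (s t : E -> V)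
    (h_in : forall v : V, exists e : E, t e = v)
    (h_out : forall v : V, exists e : E, s e = v)
    (h_E : (2 <= #|E|)%N)
    (OA : cstarAlgType R) (S : E -> OA)
    (h_OA : is_cuntz_krieger_algebra (edge_adj s t) S)
    (OE : cstarAlgType R) (Shat : E -> OE)
    (h_OE : is_cuntz_algebra Shat)
    (n : nat) (u : V) :
  c_coef s S Shat n.+1 u =
    (\sum_(k < n.+1)
       c_coef s S Shat (n - k) u *
         \sum_(v : V) vertex_adj s t v u * c_coef s S Shat k v)%N.
Proof.
have [S_CK _ _] := h_OA; have [T_cuntz _ _] := h_OE.
have OE_neq0 := cuntz_algebra_neq0 (ltnW h_E) h_OE.
have Pv_neq0 := CK_algebra_vertex_proj_neq0 h_out h_OA.
have cE := c_coefE S_CK T_cuntz h_E OE_neq0 Pv_neq0.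
rewrite cE walk_count_rec; apply: eq_bigr => k _.
by rewrite cE; under [in RHS]eq_bigr => v _ do rewrite cE.
Qed.
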